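(* Let $G$ be a graph on $[n]$. Then $$\operatorname{depth} S/J_G\geq \xi(G).$$ In particular, if $G$ is connected, then $$\operatorname{depth} S/J_G\geq f(G)+\operatorname{diam}(G).$$
   Context: All graphs are finite and simple. Here $[n]=\{1,\ldots,n\}$, $\mathbb{K}$ is a field and $S=\mathbb{K}[x_1,\ldots,x_n,y_1,\ldots,y_n]$. The binomial edge ideal of a graph $G$ on $[n]$ is the ideal $J_G\subseteq S$ generated by the binomials $f_{ij}=x_iy_j-x_jy_i$ with $\{i,j\}\in E(G)$, $1\le i<j\le n$. The depth is taken with respect to the maximal homogeneous ideal $\mathfrak{m}=(x_1,\ldots,x_n,y_1,\ldots,y_n)$: $\operatorname{depth} S/J_G=\min\{i: H^i_{\mathfrak m}(S/J_G)\neq 0\}$, where $H^i_{\mathfrak m}$ is local cohomology. A vertex $v$ of $G$ is free if the induced subgraph of $G$ on its neighbourhood $N_G(v)$ is a complete graph (in particular an isolated vertex is free); $f(G)$ is the number of free vertices of $G$. For a connected graph $H$, $\operatorname{diam}(H)$ is the maximum over $u,v\in V(H)$ of the length $d_H(u,v)$ of a shortest path between $u$ and $v$. If $G$ has connected components $G_1,\ldots,G_t$ and $\mathfrak{i}(G)$ is the number of isolated vertices of $G$, put $d(G)=\mathfrak{i}(G)+\sum_{i=1}^t\operatorname{diam}(G_i)$. Finally $\xi(G)=f(G)+d(G)$. *)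

(* Defs.v *)
From HB Require Import structures.
From mathcomp Require Import all_boot all_order all_algebra.
From mathcomp Require Import boolp mpoly.

Set Implicit Arguments.
Unset Strict Implicit.
Unset Printing Implicit Defensive.

Import GRing.Theory.
Local Open Scope ring_scope.
Local Open Scope quotient_scope.

(** * Ideals and quotient modules *)

Section QuotientModule.
Variables (R : comNzRingType) (V : lmodType R) (N : submodClosed V).

Definition submod_pred : {pred V} := fun x => x \in N.

Lemma submod_zmod_closed : zmod_closed submod_pred.
Proof.
split=> [|x y xN yN]; first exact: (rpred0 N).
by rewrite -scaleN1r; apply: (rpredD (S := N)); rewrite ?rpredZ.
Qed.

(* submodClosed does not inherit from the zmodClosed that Quotient.quot needs. *)
HB.instance Definition _ :=
  GRing.isZmodClosed.Build V submod_pred submod_zmod_closed.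

Definition quot_mod : Type := Quotient.quot submod_pred.
HB.instance Definition _ := GRing.Zmodule.on quot_mod.

Definition quot_scale (a : R) (x : quot_mod) : quot_mod :=
  \pi_(Quotient.quot submod_pred) (a *: repr x).

Lemma quot_scale_pi a x :
  quot_scale a (\pi_(Quotient.quot submod_pred) x) =
  \pi_(Quotient.quot submod_pred) (a *: x).
Proof.
apply/eqP; rewrite -Quotient.idealrBE -scalerBr.
have: repr (\pi_(Quotient.quot submod_pred) x) - x \in submod_pred.
  by rewrite Quotient.idealrBE reprK.
by rewrite !unfold_in; apply: (rpredZ (s := N)).
Qed.

Lemma quot_scaleA a b x : quot_scale a (quot_scale b x) = quot_scale (a * b) x.
Proof. by rewrite [quot_scale b x]/quot_scale quot_scale_pi scalerA. Qed.

Lemma quot_scale1 : left_id 1 quot_scale.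
Proof. by move=> x; rewrite /quot_scale scale1r reprK. Qed.

Lemma quot_scaleDr : right_distributive quot_scale +%R.
Proof.
move=> a x y; rewrite -[x](@reprK V) -[y](@reprK V) -raddfD.
by rewrite !quot_scale_pi scalerDr raddfD.
Qed.

Lemma quot_scaleDl x : {morph quot_scale^~ x : a b / a + b}.
Proof. by move=> a b; rewrite /quot_scale scalerDl raddfD. Qed.

HB.instance Definition _ := GRing.Zmodule_isLmodule.Build R quot_mod
  quot_scaleA quot_scale1 quot_scaleDr quot_scaleDl.
End QuotientModule.

Section Ideal.
Variables (R : comNzRingType) (I : finType) (P : pred I) (g : I -> R).

(* The ideal of R generated by the g i with P i. *)
Definition ideal_gen : {pred R^o} :=
  fun p => `[< exists h : I -> R, p = \sum_(i | P i) h i * g i >].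

Lemma ideal_gen_submod_closed : submod_closed ideal_gen.
Proof.
split=> [|a u v /asboolP[h ->] /asboolP[k ->]]; apply/asboolP.
  by exists (fun=> 0); rewrite big1 // => i _; rewrite mul0r.
exists (fun i => a * h i + k i); rewrite scaler_sumr -big_split /=.
by apply: eq_bigr => i _; rewrite mulrDl -mulrA.
Qed.

HB.instance Definition _ :=
  GRing.isSubmodClosed.Build R R^o ideal_gen ideal_gen_submod_closed.
End Ideal.

(** * Local cohomology and depth *)

Section LocalCohomology.
Variable R : comNzRingType.

Definition injective_module (Q : lmodType R) : Prop :=
  forall (A B : lmodType R) (i : {linear A -> B}) (f : {linear A -> Q}),
    injective i -> exists g : {linear B -> Q}, forall a, g (i a) = f a.

Record injective_resolution (M : lmodType R) := InjectiveResolution {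
  res_obj :> nat -> lmodType R;
  res_aug : {linear M -> res_obj 0};
  res_diff : forall i, {linear res_obj i -> res_obj i.+1};
  res_injective : forall i, injective_module (res_obj i);
  res_aug_inj : injective res_aug;
  res_exact0 : forall x, res_diff 0 x = 0 <-> exists m, x = res_aug m;
  res_exact : forall i x, res_diff i.+1 x = 0 <-> exists y, x = res_diff i y }.

Variable a : {pred R}.

(* Gamma_a(M), the elements killed by some power a^t; the ideal a^t is
   generated by the products of t elements of a. *)
Definition torsion (M : lmodType R) (x : M) : Prop :=
  exists t, forall s : t.-tuple R, all (mem a) s -> (\prod_(c <- s) c) *: x = 0.

Section Complex.
Variables (M : lmodType R) (E : injective_resolution M).

Definition lc_cocycle i (z : E i) : Prop := torsion z /\ res_diff E i z = 0.

Definition lc_coboundary i : E i -> Prop :=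
  match i with
  | 0 => fun z => z = 0
  | j.+1 => fun z => exists2 y : E j, torsion y & z = res_diff E j y
  end.
End Complex.

(* H^i_a(M) != 0, where H^i_a is the i-th right derived functor of Gamma_a;
   it does not depend on the injective resolution used to compute it. *)
Definition local_cohomology_neq0 (M : lmodType R) (i : nat) : Prop :=
  exists (E : injective_resolution M) (z : E i),
    lc_cocycle z /\ ~ lc_coboundary z.

(* min {i : H^i_a(M) != 0}, where None stands for min of the empty set,
   i.e., +oo. *)
Definition depth (M : lmodType R) : option nat :=
  match pselect (exists i, `[< local_cohomology_neq0 M i >]) with
  | left h => Some (ex_minn h)
  | right _ => None
  end.
End LocalCohomology.

Definition le_enat (k : nat) (d : option nat) : bool :=
  if d is Some d' then (k <= d')%N else true.

(** * Graphs *)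

Section Graph.
Variables (T : finType) (e : rel T).

Definition free_vertex (v : T) : bool :=
  [forall u, forall w, [&& e v u, e v w & u != w] ==> e u w].

Definition num_free : nat := #|[set v | free_vertex v]|.

Definition num_isolated : nat := #|[set v | [forall u, ~~ e v u]]|.

Definition has_walk (u v : T) (k : nat) : bool :=
  [exists p : k.-tuple T, path e u p && (last u p == v)].

(* A shortest path has fewer than #|T| edges, so this is the distance whenever
   u and v are connected (and the junk value #|T| otherwise). *)
Definition dist (u v : T) : nat := find (has_walk u v) (iota 0 #|T|).

Definition diam : nat := (\max_(u : T) \max_(v : T) dist u v)%N.

Definition connected_graph : Prop := forall u v : T, connect e u v.

Definition components : {set {set T}} :=
  equivalence_partition (connect e) [set: T].
End Graph.

Definition induced (T : finType) (e : rel T) (A : {set T}) :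
  rel {x : T | x \in A} := fun u v => e (val u) (val v).

Definition graph_d (T : finType) (e : rel T) : nat :=
  (num_isolated e + \sum_(C in components e) diam (@induced T e C))%N.

Definition graph_xi (T : finType) (e : rel T) : nat :=
  (num_free e + graph_d e)%N.

(** * Binomial edge ideals *)

Section BinomialEdgeIdeal.
Variables (K : fieldType) (n : nat).

Definition bei_ring : comNzRingType := {mpoly K[n + n]}.

Definition bei_x (i : 'I_n) : bei_ring := 'X_(lshift n i).
Definition bei_y (i : 'I_n) : bei_ring := 'X_(rshift n i).

Definition bei_f (i j : 'I_n) : bei_ring :=
  bei_x i * bei_y j - bei_x j * bei_y i.

Definition max_ideal : {pred bei_ring} :=
  ideal_gen predT (fun k : 'I_(n + n) => 'X_k : bei_ring).

Variable e : rel 'I_n.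

Definition binomial_edge_ideal : submodClosed bei_ring^o :=
  @ideal_gen bei_ring ('I_n * 'I_n)%type
    (fun ij => (ij.1 < ij.2)%N && e ij.1 ij.2) (fun ij => bei_f ij.1 ij.2).

(* depth S/J_G *)
Definition depth_bei : option nat :=
  depth max_ideal (quot_mod binomial_edge_ideal).
End BinomialEdgeIdeal.

(* Main.v *)
Require Import Defs.
From HB Require Import structures.
From mathcomp Require Import all_boot all_order all_algebra.
From mathcomp Require Import boolp freeg mpoly.
From mathcomp Require Import ring zify.

(** Write J for the binomial edge ideal, m for the maximal ideal and G_v for the
   graph obtained from G by making the neighbourhood of v complete.

   Depth is controlled through Ext^i(N, M) for the modules N killed by m.
   Computing Ext from the syzygies of N makes it functorial in M, so that short
   exact sequences and regular elements give depth estimates by diagram chases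
   in the second argument ([depth_ge_exact], [depth_ge_regular]).  Dimension
   shifting in N, along whatever injective resolution of M is given, turns the
   vanishing of Ext into the lifting of cocycles, first for N killed by m, then
   by socle filtrations for N killed by a power of m; the m-torsion cocycles
   with a common exponent form such a module, whence the vanishing of local
   cohomology ([depth_ge_le_depth]).

   For every vertex v,
     J_G = J_(G_v) cap ((x_v, y_v) + J_(G - v)),
   and these two ideals add up to (x_v, y_v) + J_(G_v - v), so that depth S/J_G
   is at least the minimum of the depths for G_v and G - v and of one plus the
   depth for G_v - v ([edge_depth_complete]).  If v is not free, all three
   graphs have fewer non-free vertices than G.  The induction ends with
   disjoint unions of complete graphs; there x_v is regular, and adding it to J
   gives an intersection of two simpler ideals ([cluster_depth]).

   It remains to choose v so that f + d does not drop for G - v and G_v and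
   drops by at most one for G_v - v.  In G_v and G_v - v distances decrease by
   at most one, and v becomes free in G_v, so the only danger is that G - v has
   more components than G.
   Instead of diameters, the induction carries one pair of vertices per
   component together with a lower bound for their distance ([far_system]).
   Deleting v does no harm as long as v neither separates nor belongs to the
   pair of its component.  If every non-free vertex does one of the two, then
   all non-free vertices of a component lie on a shortest path between its two
   selected vertices, and the rest of the component consists of cliques hanging
   off this path; then some interior vertex of the path splits it without loss
   ([good_split_exists]). *)

Set Implicit Arguments.
Unset Strict Implicit.
Unset Printing Implicit Defensive.

Import GRing.Theory.
Local Open Scope ring_scope.
Local Open Scope quotient_scope.

(** * Linear maps between modules *)

Section LinearMaps.
Variable R : comNzRingType.
Implicit Types A B C M N X : lmodType R.

Definition to_linear A B (f : A -> B) (f_lin : linear f) : {linear A -> B} :=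
  HB.pack f (GRing.isLinear.Build R A B *:%R f f_lin).

Lemma factor_surj B C X (p : {linear B -> C}) (u : {linear B -> X}) :
    (forall c, exists b, p b = c) -> (forall b, p b = 0 -> u b = 0) ->
  exists v : {linear C -> X}, forall b, v (p b) = u b.
Proof.
move=> p_surj ker_pu; pose s c := sval (cid (p_surj c)).
have ps c : p (s c) = c by rewrite /s; case: cid.
have us b c : p b = c -> u (s c) = u b.
  move=> pb; apply/eqP; rewrite -subr_eq0 -linearB; apply/eqP/ker_pu.
  by rewrite linearB ps pb subrr.
have v_lin : linear (u \o s).
  by move=> a x y /=; rewrite -linearP; apply: us; rewrite linearP !ps.
by exists (to_linear v_lin) => b /=; apply: us.
Qed.

Lemma factor_inj A B X (a : {linear A -> B}) (f : {linear X -> B}) :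
    injective a -> (forall x, exists y, a y = f x) ->
  exists g : {linear X -> A}, forall x, a (g x) = f x.
Proof.
move=> a_inj im_af; pose g x := sval (cid (im_af x)).
have ag x : a (g x) = f x by rewrite /g; case: cid.
have g_lin : linear g.
  by move=> c x y; apply: a_inj; rewrite linearP !ag linearP.
by exists (to_linear g_lin).
Qed.

Section Submodule.
Variables (M : lmodType R) (S : submodClosed M).

Definition submodule : Type := {x : M | x \in S}.
HB.instance Definition _ := Choice.on submodule.
HB.instance Definition _ := [isSub of submodule for @sval M (fun x => x \in S)].
HB.instance Definition _ := [SubChoice_isSubLmodule of submodule by <:].

Definition submod_incl : {linear submodule -> M} := val.

Lemma submod_incl_inj : injective submod_incl. Proof. exact: val_inj. Qed.

Lemma submod_inclP x : x \in S -> exists y, submod_incl y = x.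
Proof. by move=> Sx; exists (exist _ x Sx). Qed.

Lemma submod_incl_in y : submod_incl y \in S. Proof. exact: valP. Qed.

Definition quot_proj (x : M) : quot_mod S :=
  \pi_(Quotient.quot (submod_pred S)) x.

Lemma quot_proj_linear : linear quot_proj.
Proof.
move=> a x y; rewrite /quot_proj raddfD; congr (_ + _).
by rewrite -[RHS]/(quot_scale _ _) quot_scale_pi.
Qed.

HB.instance Definition _ :=
  GRing.isLinear.Build R M (quot_mod S) *:%R quot_proj quot_proj_linear.

Lemma quot_proj_eq0 x : (quot_proj x = 0) <-> (x \in S).
Proof.
have -> : x \in S = (x - 0 \in submod_pred S) by rewrite subr0.
rewrite Quotient.idealrBE; split=> [x0|/eqP x0].
  by apply/eqP; rewrite -[LHS]/(quot_proj x) x0 -(linear0 quot_proj).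
by rewrite -(linear0 quot_proj).
Qed.

Lemma quot_proj_surj (y : quot_mod S) : exists x, quot_proj x = y.
Proof. by exists (repr y); rewrite /quot_proj reprK. Qed.
End Submodule.

Section Kernel.
Variables (M N : lmodType R) (f : {linear M -> N}).

Definition kernel : {pred M} := fun x => f x == 0.

Lemma kernel_submod_closed : submod_closed kernel.
Proof.
split=> [|a x y /eqP fx /eqP fy]; rewrite !unfold_in ?linear0 //.
by rewrite linearP fx fy scaler0 addr0.
Qed.
HB.instance Definition _ := GRing.isSubmodClosed.Build R M kernel kernel_submod_closed.
End Kernel.

(** * Free covers and syzygies *)

(** All elements of N serve as a basis, so that no choice of generators enters. *)
Definition free_cover N : lmodType R := {freeg N / R}.

Lemma fglift_linear N M (f : N -> M) : linear (fglift f : free_cover N -> M).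
Proof.
have fB : {morph fglift f : x y / x - y} by exact: lift_is_additive.
have fl0 : fglift f 0 = 0 by rewrite -(subrr 0) fB subrr.
have fD : {morph fglift f : x y / x + y}.
  by move=> x y; rewrite -{1}[y]opprK fB -(sub0r y) fB fl0 sub0r opprK.
pose F : {additive free_cover N -> M} :=
  HB.pack (fglift f) (GRing.isZmodMorphism.Build (free_cover N) M (fglift f) fB).
move=> a x y; rewrite fD; congr (_ + _).
have -> : a *: x = \sum_(z <- dom x) [freeg [:: (a * coeff z x, z)]] by [].
have Fsum s (G : N -> free_cover N) :
    fglift f (\sum_(z <- s) G z) = \sum_(z <- s) fglift f (G z).
  exact: (raddf_sum F).
rewrite -[in RHS](freeg_sumE x) !Fsum scaler_sumr.
by apply: eq_bigr => i _; rewrite !liftU scalerA.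
Qed.

Definition cover_map N : {linear free_cover N -> N} :=
  to_linear (fglift_linear id).

Lemma cover_map_surj N n : exists x, cover_map N x = n.
Proof. by exists [freeg [:: (1, n)]]; rewrite /= liftU scale1r. Qed.

Lemma free_cover_ext N M (f g : {linear free_cover N -> M}) :
  (forall n, f [freeg [:: (1, n)]] = g [freeg [:: (1, n)]]) -> f =1 g.
Proof.
move=> fg x; rewrite -[x]freeg_sumE !raddf_sum; apply: eq_bigr => i _.
have -> : [freeg [:: (coeff i x, i)]] =
          coeff i x *: ([freeg [:: (1, i)]] : free_cover N).
  by apply/eqP/freeg_eqP=> j; rewrite coeffZ !coeffU mul1r.
set u := ([freeg _] : free_cover N); rewrite -[LHS]/(f _) -[RHS]/(g _).
by rewrite (linearZ_LR f) (linearZ_LR g) fg.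
Qed.

Lemma free_cover_projective N B C (g : {linear B -> C})
    (f : {linear free_cover N -> C}) : (forall x, exists b, g b = f x) ->
  exists h : {linear free_cover N -> B}, forall x, g (h x) = f x.
Proof.
move=> im_fg; pose s n := sval (cid (im_fg [freeg [:: (1, n)]])).
exists (to_linear (fglift_linear s)).
apply: (@free_cover_ext _ _ (g \o to_linear (fglift_linear s)) f) => n.
by rewrite /= liftU scale1r /s; case: cid.
Qed.

Definition syzygy N : lmodType R := submodule (kernel (cover_map N)).
Definition syz_incl N : {linear syzygy N -> free_cover N} :=
  submod_incl (kernel (cover_map N)).

Lemma cover_syz N x : cover_map N (syz_incl N x) = 0.
Proof. exact/eqP/(submod_incl_in (S := kernel (cover_map N))). Qed.

Lemma syzP N x : cover_map N x = 0 -> exists y, syz_incl N y = x.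
Proof. by move/eqP=> x0; apply: (@submod_inclP _ (kernel (cover_map N))). Qed.
End LinearMaps.

(** * Vanishing of Ext *)

Section Ext.
Variable R : comNzRingType.
Implicit Types A B C M N : lmodType R.

Definition extends_along A B M (j : {linear A -> B}) (phi : {linear A -> M}) :=
  exists psi : {linear B -> M}, forall x, psi (j x) = phi x.

Definition hom_zero N M := forall (phi : {linear N -> M}) x, phi x = 0.

Definition ext1_zero N M :=
  forall phi : {linear syzygy N -> M}, extends_along (syz_incl N) phi.

(** Ext^(i+1)(N, M) is the cokernel of Hom(F, M) -> Hom(Z, M), where Z is the
   kernel of the free cover F of the i-th syzygy of N. *)
Definition ext_zero i N M :=
  if i is j.+1 then ext1_zero (iter j (@syzygy R) N) M else hom_zero N M.

Section ShortExact.
Variables (A B C : lmodType R) (a : {linear A -> B}) (p : {linear B -> C}).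
Hypotheses (a_inj : injective a) (p_surj : forall c, exists b, p b = c).
Hypothesis ap_exact : forall b, p b = 0 <-> exists x, a x = b.

(** Exactness of Hom(N, C) -> Ext^1(N, A) -> Ext^1(N, B): an extension of
   a o phi to the free cover becomes, modulo A, a map N -> C. *)
Lemma ext_lift0 N (phi : {linear syzygy N -> A}) :
  hom_zero N C -> extends_along (syz_incl N) (a \o phi) ->
  extends_along (syz_incl N) phi.
Proof.
move=> homNC [psi psiE].
have [x x0|theta thetaE] := factor_surj (@cover_map_surj R N) (u := p \o psi).
  have [y <-] := syzP x0; rewrite /= psiE /=.
  by apply/ap_exact; exists (phi y).
have [x|psi' psi'E] := factor_inj (f := psi) a_inj.
  by apply/ap_exact; rewrite -[p _]thetaE homNC.
by exists psi' => x; apply: a_inj; rewrite psi'E psiE.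
Qed.

(** Exactness of Ext^1(N, C) -> Ext^2(N, A) -> Ext^2(N, B): modulo A, an
   extension psi of a o phi defines a map from the syzygy of N to C; it extends
   to the free cover of N and lifts to B, and the lift corrects psi. *)
Lemma ext_lift1 N (phi : {linear syzygy (syzygy N) -> A}) :
  ext1_zero N C -> extends_along (syz_incl (syzygy N)) (a \o phi) ->
  extends_along (syz_incl (syzygy N)) phi.
Proof.
move=> ext1NC [psi psiE].
have [x x0|theta thetaE] :=
    factor_surj (@cover_map_surj R (syzygy N)) (u := p \o psi).
  have [y <-] := syzP x0; rewrite /= psiE /=.
  by apply/ap_exact; exists (phi y).
have [theta' theta'E] := ext1NC theta.
have [chi chiE] := free_cover_projective (f := theta') (fun x => p_surj _).
pose psi1 : {linear free_cover (syzygy N) -> B} :=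
  psi \- (chi \o (syz_incl N \o cover_map (syzygy N))).
have [x|psi' psi'E] := factor_inj (f := psi1) a_inj.
  apply/ap_exact; rewrite /psi1 /= linearB /= chiE theta'E thetaE /=.
  by rewrite subrr.
exists psi' => x; apply: a_inj; rewrite psi'E /psi1 /= psiE /=.
by rewrite -[fglift _ _]/(cover_map _ _) cover_syz !linear0 addr0.
Qed.

Lemma ext_lift i N (phi : {linear syzygy (iter i (@syzygy R) N) -> A}) :
  ext_zero i N C -> extends_along (syz_incl _) (a \o phi) ->
  extends_along (syz_incl _) phi.
Proof. by case: i phi => [|i] phi; [apply: ext_lift0 | apply: ext_lift1]. Qed.
End ShortExact.

Lemma syzygy_annihilated_step N (f : R) (g : {linear free_cover N -> syzygy N}) :
    (forall x, g (syz_incl N x) = f *: x) ->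
  exists g' : {linear free_cover (syzygy N) -> syzygy (syzygy N)},
    forall x, g' (syz_incl _ x) = f *: x.
Proof.
move=> gE.
have [h hE] := free_cover_projective (f := g) (fun x => cover_map_surj _).
have fZ_linear : linear ( *:%R f : free_cover (syzygy N) -> _).
  by move=> c x y; rewrite scalerDr !scalerA mulrC.
pose k : {linear free_cover (syzygy N) -> free_cover (syzygy N)} :=
  to_linear fZ_linear \- (h \o (syz_incl N \o cover_map (syzygy N))).
have [x|g' g'E] :=
    factor_inj (f := k) (@submod_incl_inj _ _ (kernel (cover_map (syzygy N)))).
  apply: syzP; rewrite /k; set c := cover_map _.
  rewrite linearB linearZ_LR /=.
  by rewrite -[fglift _ (h _)]/(cover_map _ _) hE gE subrr.
exists g' => x; apply: (@submod_incl_inj _ _ (kernel (cover_map (syzygy N)))).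
rewrite g'E /k /= -[fglift _ _]/(cover_map _ _).
by rewrite -[sval x]/(syz_incl _ x) cover_syz !linear0 addr0.
Qed.

(** Multiplication by f on the resolution of N is homotopic to zero when f
   kills N; g is the component of the homotopy that matters. *)
Lemma syzygy_annihilated N (f : R) i : (forall n : N, f *: n = 0) ->
  exists g : {linear free_cover (iter i (@syzygy R) N) -> syzygy (iter i (@syzygy R) N)},
    forall x, g (syz_incl _ x) = f *: x.
Proof.
move=> fN; elim: i => [|i [g gE]]; last exact: syzygy_annihilated_step gE.
have fZ_linear : linear ( *:%R f : free_cover N -> _).
  by move=> c x y; rewrite scalerDr !scalerA mulrC.
have [x|g gE] := factor_inj (f := to_linear fZ_linear)
    (@submod_incl_inj _ _ (kernel (cover_map N))).
  by apply: syzP; rewrite [LHS]linearZ_LR fN.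
exists g => x; apply: (@submod_incl_inj _ _ (kernel (cover_map N))).
by rewrite gE.
Qed.

Lemma ext_annihilated N M (f : R) i (phi : {linear syzygy (iter i (@syzygy R) N) -> M})
    (a : {linear M -> M}) :
    (forall n : N, f *: n = 0) -> (forall m, a m = f *: m) ->
  extends_along (syz_incl _) (a \o phi).
Proof.
move=> fN aE; have [g gE] := syzygy_annihilated i fN.
by exists (phi \o g) => x; rewrite /= gE aE linearZ_LR.
Qed.

(** * Depth *)

Variable m : {pred R}.

Definition annihilated N := forall c (n : N), c \in m -> c *: n = 0.

(** Ext^i(N, M) = 0 for all i < k and all N killed by m, and not only for
   N = R/m: this class also contains the graded pieces of the socle filtrations
   of torsion modules. *)
Definition depth_ge k M :=
  forall N, annihilated N -> forall i, (i < k)%N -> ext_zero i N M.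

Lemma depth_ge_leq k l M : (l <= k)%N -> depth_ge k M -> depth_ge l M.
Proof. by move=> lk kM N Nm i il; apply: kM; rewrite ?(leq_trans il). Qed.

Lemma depth_ge_exact k A B C (a : {linear A -> B}) (p : {linear B -> C}) :
    injective a -> (forall c, exists b, p b = c) ->
    (forall b, p b = 0 <-> exists x, a x = b) ->
  depth_ge k B -> depth_ge k.-1 C -> depth_ge k A.
Proof.
move=> a_inj p_surj exact_ap kB kC N mN [|i] ik.
  by move=> phi x; apply: a_inj; rewrite linear0; apply: (kB N mN _ ik (a \o phi)).
move=> phi; apply: (ext_lift a_inj p_surj exact_ap); last exact: (kB N mN _ ik).
by apply: kC => //; rewrite -ltnS prednK // (leq_trans _ ik).
Qed.

(** Multiplication by f on Ext^(i+1)(N, M) is injective because Ext^i(N, M/fM)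
   vanishes, and zero because f kills N. *)
Lemma depth_ge_regular k M C (f : R) (p : {linear M -> C}) :
    f \in m -> (forall x : M, f *: x = 0 -> x = 0) ->
    (forall c, exists b, p b = c) ->
    (forall b, p b = 0 <-> exists x, f *: x = b) ->
  depth_ge k C -> depth_ge k.+1 M.
Proof.
move=> fm f_reg p_surj exact_fp kC N mN [|i] ik.
  by move=> phi x; apply: f_reg; rewrite -linearZ_LR mN // linear0.
have fZ_linear : linear ( *:%R f : M -> _).
  by move=> c x y; rewrite scalerDr !scalerA mulrC.
move=> phi; apply: (@ext_lift _ _ _ (to_linear fZ_linear) p) => //.
- move=> x y /= /eqP; rewrite -subr_eq0 -scalerBr => /eqP/f_reg/eqP.
  by rewrite subr_eq0 => /eqP.
- by apply: kC.
- by apply: (ext_annihilated (f := f)) => // n; apply: mN.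
Qed.

(** * Local cohomology *)

Section Resolution.
Variables (M : lmodType R) (E : injective_resolution M).

(** The i-th cohomology of Hom(N, E) vanishes. *)
Definition cocycles_bound i N :=
  if i is j.+1 then
    forall z : {linear N -> E j.+1}, (forall n, res_diff E j.+1 (z n) = 0) ->
    exists y : {linear N -> E j}, forall n, z n = res_diff E j (y n)
  else forall z : {linear N -> E 0}, (forall n, res_diff E 0 (z n) = 0) ->
    forall n, z n = 0.

Lemma res_diff_aug x : res_diff E 0 (res_aug E x) = 0.
Proof. by apply/res_exact0; exists x. Qed.

Lemma res_diff_diff i x : res_diff E i.+1 (res_diff E i x) = 0.
Proof. by apply/res_exact; exists x. Qed.

(** Dimension shifting: on the free cover of N, the map z lifts through d';
   the obstruction to descending the lift u to N is the restriction of u to the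
   syzygy, which is a cocycle one degree lower. *)
Lemma cocycle_shift N A B C (d : {linear A -> B}) (d' : {linear B -> C})
    (z : {linear N -> C}) :
    (forall x, d' (d x) = 0) -> (forall n, exists y, d' y = z n) ->
    (forall w : {linear syzygy N -> B}, (forall x, d' (w x) = 0) ->
     exists w' : {linear free_cover N -> A},
       forall x, d (w' (syz_incl N x)) = w x) ->
  exists y : {linear N -> B}, forall n, z n = d' (y n).
Proof.
move=> dd im_z lift_w.
have [u uE] := free_cover_projective (f := z \o cover_map N) (fun x => im_z _).
have [x|w wE] := lift_w (u \o syz_incl N).
  by rewrite [LHS]uE /= [X in z X](cover_syz x) linear0.
pose u' : {linear free_cover N -> B} := u \- (d \o w).
have [x x0|y yE] := factor_surj (@cover_map_surj R N) (u := u').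
  by have [x' <-] := syzP x0; rewrite /u' /= wE subrr.
exists y => n; have [x <-] := cover_map_surj n.
by rewrite yE /u' /= linearB dd subr0 uE.
Qed.

Lemma ext_zero_cocycles i N : ext_zero i N M -> cocycles_bound i N.
Proof.
case: i => [|i] extNM.
  move=> z dz n; have [x|w wE] := factor_inj (f := z) (@res_aug_inj _ _ E).
    by have /res_exact0[y ->] := dz x; exists y.
  by rewrite -wE extNM linear0.
elim: i => [|i IHi] in N extNM *.
  move=> z dz; apply: cocycle_shift (@res_diff_aug) _ _ => [n|w dw].
    by have /res_exact[y ->] := dz n; exists y.
  have [x|v vE] := factor_inj (f := w) (@res_aug_inj _ _ E).
    by have /res_exact0[y ->] := dw x; exists y.
  by have [v' v'E] := extNM v; exists v' => x; rewrite v'E vE.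
move=> z dz; apply: cocycle_shift (@res_diff_diff i) _ _ => [n|w dw].
  by have /res_exact[y ->] := dz n; exists y.
have {}extNM : ext_zero i.+1 (syzygy N) M by rewrite /= -iterSr.
have [v vE] := IHi _ extNM w dw.
have [v' v'E] := res_injective v (@submod_incl_inj _ _ (kernel (cover_map N))).
by exists v' => x; rewrite v'E vE.
Qed.

(** The long exact sequence of Hom(-, E) for S -> N -> N/S, which only uses the
   injectivity of the terms of E. *)
Lemma cocycles_bound_extension i N (S : submodClosed N) :
  cocycles_bound i (submodule S) -> cocycles_bound i (quot_mod S) ->
  cocycles_bound i N.
Proof.
case: i => [|i] boundS boundQ z dz.
  have [n /quot_proj_eq0/submod_inclP[x <-]|zQ zQE] :=
      factor_surj (@quot_proj_surj _ _ S) (u := z).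
    exact: (boundS (z \o submod_incl S) (fun y => dz _) x).
  move=> n; rewrite -zQE; apply: boundQ => q.
  by have [n' <-] := quot_proj_surj q; rewrite zQE.
have [x|y yE] := boundS (z \o submod_incl S); first exact: dz.
have [y1 y1E] := res_injective y (@submod_incl_inj _ _ S).
pose z1 : {linear N -> E i.+1} := z \- (res_diff E i \o y1).
have [n /quot_proj_eq0/submod_inclP[x <-]|zQ zQE] :=
    factor_surj (@quot_proj_surj _ _ S) (u := z1).
  by rewrite /z1 /= [z _]yE y1E subrr.
have [q|yQ yQE] := boundQ zQ.
  have [n' <-] := quot_proj_surj q.
  by rewrite zQE /z1 /= linearB dz res_diff_diff subrr.
exists (y1 \+ (yQ \o quot_proj S)) => n.
by rewrite /= linearD -yQE zQE /z1 /= addrC subrK.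
Qed.

Definition pow_annihilated t N := forall s : t.-tuple R, all (mem m) s ->
  forall n : N, (\prod_(c <- s) c) *: n = 0.

Section Socle.
Variable N : lmodType R.

(** If m^(t+1) kills N, then m^t kills the quotient of N by its socle. *)
Definition socle : {pred N} := fun n => `[< forall c, c \in m -> c *: n = 0 >].

Lemma socle_submod_closed : submod_closed socle.
Proof.
split=> [|a x y /asboolP x0 /asboolP y0]; apply/asboolP => c cm.
  by rewrite scaler0.
by rewrite scalerDr scalerA mulrC -scalerA x0 // y0 // scaler0 addr0.
Qed.
HB.instance Definition _ :=
  GRing.isSubmodClosed.Build R N socle socle_submod_closed.
End Socle.

Lemma cocycles_bound_pow i : (forall N, annihilated N -> cocycles_bound i N) ->
  forall t N, pow_annihilated t N -> cocycles_bound i N.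
Proof.
move=> bound1; elim=> [|t IHt] N mtN.
  have N0 (n : N) : n = 0.
    by have := mtN [tuple] isT n; rewrite big_nil scale1r.
  case: i {bound1} => [|i] z dz => [n|]; first by rewrite (N0 n) linear0.
  by exists \0 => n; rewrite (N0 n) !linear0.
apply: (@cocycles_bound_extension _ _ (@socle N)).
  apply: bound1 => c n cm; apply: (@submod_incl_inj _ _ (@socle N)).
  rewrite linearZ_LR linear0.
  by have /asboolP := submod_incl_in n; apply.
apply: IHt => s sm q; have [n <-] := quot_proj_surj q.
rewrite -linearZ_LR; apply/quot_proj_eq0/asboolP => c cm.
have := mtN [tuple of c :: s] _ n.
by rewrite /= cm => /(_ sm); rewrite big_cons scalerA.
Qed.

Section TorsionCocycles.
Variables (t i : nat).

(** For a single torsion cocycle z, the lifting of cocycles is applied to the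
   inclusion of this module; it gives a preimage of z killed by m^t as well. *)
Definition pow_cocycles : {pred E i} := fun z => `[< res_diff E i z = 0 /\
  forall s : t.-tuple R, all (mem m) s -> (\prod_(c <- s) c) *: z = 0 >].

Lemma pow_cocycles_submod_closed : submod_closed pow_cocycles.
Proof.
split=> [|a x y /asboolP[dx x0] /asboolP[dy y0]]; apply/asboolP.
  by rewrite linear0; split=> // s _; rewrite scaler0.
split=> [|s sm]; first by rewrite linearP dx dy scaler0 addr0.
by rewrite scalerDr scalerA mulrC -scalerA x0 // y0 // scaler0 addr0.
Qed.
HB.instance Definition _ :=
  GRing.isSubmodClosed.Build R (E i) pow_cocycles pow_cocycles_submod_closed.
End TorsionCocycles.

Lemma depth_ge_coboundary k i (z : E i) :
  depth_ge k M -> (i < k)%N -> lc_cocycle m z -> lc_coboundary m z.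
Proof.
move=> kM ik [[t z0] dz].
have mtT : pow_annihilated t (submodule (@pow_cocycles t i)).
  move=> s sm x; apply: (@submod_incl_inj _ _ (@pow_cocycles t i)).
  rewrite linearZ_LR linear0.
  by have /asboolP[_] := submod_incl_in x; apply.
have : cocycles_bound i (submodule (@pow_cocycles t i)).
  by apply: cocycles_bound_pow mtT => N Nm; apply/ext_zero_cocycles/kM.
have [x xE] : exists x, submod_incl (@pow_cocycles t i) x = z.
  by apply: submod_inclP; apply/asboolP.
have dT y : res_diff E i (submod_incl (@pow_cocycles t i) y) = 0.
  by have /asboolP[] := submod_incl_in y.
case: i ik z z0 dz mtT x xE dT => [|i] ik z z0 dz mtT x xE dT bound.
  by rewrite /= -xE; apply: (bound (submod_incl _)).
have [y yE] := bound _ dT.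
exists (y x); last by rewrite -yE xE.
by exists t => s sm; rewrite -linearZ_LR mtT // linear0.
Qed.
End Resolution.

Lemma depth_ge_le_depth k M : depth_ge k M -> le_enat k (depth m M).
Proof.
move=> kM; rewrite /depth; case: pselect => //= h; case: ex_minnP => i.
move=> /asboolP[E [z [zc zb]]] _; rewrite leqNgt; apply/negP => ik.
exact/zb/(depth_ge_coboundary kM ik).
Qed.
End Ext.

(** * Depth of quotients by ideals *)

Section QuotientDepth.
Variables (R : comNzRingType) (m : {pred R}).
Implicit Types M N A B : lmodType R.

Lemma depth_ge_iso k A B (a : {linear A -> B}) :
    injective a -> (forall b, exists x, a x = b) ->
  depth_ge m k B -> depth_ge m k A.
Proof.
move=> a_inj a_surj kB N mN i ik.
have [b bE] := factor_inj (f := idfun) a_inj a_surj.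
have {}kB := kB N mN i ik.
case: i {ik} => [|i] in kB * => phi => [x|].
  by apply: a_inj; rewrite linear0 -[LHS]/((a \o phi) x) kB.
have [psi psiE] := kB (a \o phi); exists (b \o psi) => x.
by apply: a_inj; rewrite /= bE psiE.
Qed.

Lemma depth_ge_prod k A B :
  depth_ge m k A -> depth_ge m k B -> depth_ge m k (A * B)%type.
Proof.
move=> kA kB N mN i ik.
have {}kA := kA N mN i ik; have {ik}kB := kB N mN i ik.
have fst_lin : linear (@fst A B) by move=> c x y.
have snd_lin : linear (@snd A B) by move=> c x y.
pose fstL := to_linear fst_lin; pose sndL := to_linear snd_lin.
case: i => [|i] in kA kB * => phi => [x|].
  rewrite [phi x]surjective_pairing.
  by congr (_, _); [apply: (kA (fstL \o phi)) | apply: (kB (sndL \o phi))].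
have [psi psiE] := kA (fstL \o phi); have [chi chiE] := kB (sndL \o phi).
have pair_lin : linear (fun x => (psi x, chi x)).
  by move=> c x y; rewrite !linearP.
exists (to_linear pair_lin) => x /=.
by rewrite psiE chiE /= -surjective_pairing.
Qed.

Variable V : lmodType R.

Lemma quot_proj_factor M (S : submodClosed V) (f : {linear V -> M}) :
    (forall x, x \in S -> f x = 0) ->
  exists g : {linear quot_mod S -> M}, forall x, g (quot_proj S x) = f x.
Proof.
move=> f0; apply: factor_surj => [q|x]; first exact: quot_proj_surj.
by move=> /quot_proj_eq0/f0.
Qed.

Lemma depth_quot_eq k (S T : submodClosed V) : S =i T ->
  depth_ge m k (quot_mod S) -> depth_ge m k (quot_mod T).
Proof.
move=> eqST.
have [x Tx|g gE] := @quot_proj_factor _ T (quot_proj S).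
  by apply/quot_proj_eq0; rewrite eqST.
apply: (@depth_ge_iso _ _ _ g) => [x y|q]; last first.
  by have [x <-] := quot_proj_surj q; exists (quot_proj T x).
have [x' <-] := quot_proj_surj x; have [y' <-] := quot_proj_surj y.
rewrite !gE => /eqP; rewrite -subr_eq0 -linearB => /eqP/quot_proj_eq0.
rewrite eqST => /quot_proj_eq0/eqP; rewrite linearB subr_eq0.
by move=> /eqP.
Qed.

(** The exact sequence 0 -> V/(S cap T) -> V/S x V/T -> V/(S + T) -> 0. *)
Lemma depth_quot_cap k (N S T U : submodClosed V) :
    (forall x, (x \in N) = (x \in S) && (x \in T)) ->
    (forall x, x \in S -> x \in U) -> (forall x, x \in T -> x \in U) ->
    (forall x, x \in U -> exists2 y, y \in S & x - y \in T) ->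
    depth_ge m k (quot_mod S) -> depth_ge m k (quot_mod T) ->
  depth_ge m k.-1 (quot_mod U) -> depth_ge m k (quot_mod N).
Proof.
move=> NE SU TU USt kS kT kU.
have pair_lin : linear (fun x => (quot_proj S x, quot_proj T x)).
  by move=> c x y; rewrite !linearP.
have [x|a aE] := quot_proj_factor (f := to_linear pair_lin) (S := N).
  rewrite NE => /andP[/quot_proj_eq0 xS /quot_proj_eq0 xT].
  exact: congr2 xS xT.
have [x /SU/quot_proj_eq0 //|pS pSE] := quot_proj_factor (f := quot_proj U) (S := S).
have [x /TU/quot_proj_eq0 //|pT pTE] := quot_proj_factor (f := quot_proj U) (S := T).
have diff_lin : linear (fun q : quot_mod S * quot_mod T => pS q.1 - pT q.2).
  by move=> c x y; rewrite /= (linearP pS) (linearP pT) scalerBr opprD addrACA.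
apply: (@depth_ge_exact _ _ _ _ _ _ a (to_linear diff_lin)) kU => //.
- move=> x y.
  have [x' <-] := quot_proj_surj x; have [y' <-] := quot_proj_surj y.
  rewrite !aE /= => -[/eqP eS /eqP eT].
  apply/eqP; rewrite -subr_eq0; rewrite -linearB; apply/eqP/quot_proj_eq0.
  rewrite NE; apply/andP; split; apply/quot_proj_eq0/eqP;
  by rewrite linearB subr_eq0.
- move=> q; have [x <-] := quot_proj_surj q.
  by exists (quot_proj S x, 0); rewrite /= linear0 subr0 pSE.
- case=> q r; split=> [|[z]]; last first.
    have [x <-] := quot_proj_surj z.
    by rewrite aE => -[<- <-]; rewrite /= pSE pTE subrr.
  have [x <-] := quot_proj_surj q; have [y <-] := quot_proj_surj r.
  rewrite /= pSE pTE => /eqP.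
  rewrite -linearB => /eqP/quot_proj_eq0/USt[s Ss Ts].
  exists (quot_proj N (x - s)); rewrite aE; congr (_, _).
    apply/eqP; rewrite -subr_eq0 -linearB; apply/eqP/quot_proj_eq0.
    by rewrite addrAC subrr add0r -scaleN1r rpredZ.
  apply/eqP; rewrite -subr_eq0 -linearB; apply/eqP/quot_proj_eq0.
  by rewrite addrAC.
- exact: depth_ge_prod.
Qed.

Lemma depth_quot_regular k (f : R) (S T : submodClosed V) :
    f \in m -> (forall x, f *: x \in S -> x \in S) ->
    (forall x, (x \in T) <-> exists y, x - f *: y \in S) ->
  depth_ge m k (quot_mod T) -> depth_ge m k.+1 (quot_mod S).
Proof.
move=> fm f_reg TE.
have [x Sx|p pE] := quot_proj_factor (f := quot_proj T) (S := S).
  by apply/quot_proj_eq0/TE; exists 0; rewrite scaler0 subr0.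
apply: (depth_ge_regular (f := f) (p := p)) => //.
- move=> q; have [x <-] := quot_proj_surj q.
  by rewrite -linearZ_LR => /quot_proj_eq0/f_reg/quot_proj_eq0.
- by move=> c; have [x <-] := quot_proj_surj c; exists (quot_proj S x).
- move=> b; have [x <-] := quot_proj_surj b; rewrite pE quot_proj_eq0 TE.
  split=> [[y Sy]|[q]].
    exists (quot_proj S y); rewrite -linearZ_LR; apply/esym/eqP.
    by rewrite -subr_eq0 -linearB; apply/eqP/quot_proj_eq0.
  have [y <-] := quot_proj_surj q; rewrite -linearZ_LR => /eqP.
  rewrite eq_sym -subr_eq0 -linearB => /eqP/quot_proj_eq0 Sy.
  by exists y.
Qed.
End QuotientDepth.

(** * Ideals given by generators *)

Section GeneratedIdeal.
Variable R : comNzRingType.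
Implicit Types P Q : R -> Prop.

Inductive generated P : R -> Prop :=
| generated0 : generated P 0
| generated_step a x y : P x -> generated P y -> generated P (a * x + y).

Lemma generated_add P x y : generated P x -> generated P y -> generated P (x + y).
Proof.
move=> Px Py; elim: Px => [|a z t Pz _ IH]; rewrite ?add0r // -addrA.
exact: generated_step.
Qed.

Lemma generated_mul P a x : generated P x -> generated P (a * x).
Proof.
elim=> [|b z t Pz _ IH]; first by rewrite mulr0; constructor.
by rewrite mulrDr mulrA; constructor.
Qed.

Lemma generated_opp P x : generated P x -> generated P (- x).
Proof. by rewrite -mulN1r; apply: generated_mul. Qed.

Lemma generated_sub P x y : generated P x -> generated P y -> generated P (x - y).
Proof. by move=> Px Py; apply/generated_add/generated_opp. Qed.

Lemma generated_in P x : P x -> generated P x.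
Proof.
move=> Px; have := @generated_step P 1 x 0 Px (generated0 P).
by rewrite mul1r addr0.
Qed.

Lemma generated_sub_in P Q x : (forall y, P y -> generated Q y) ->
  generated P x -> generated Q x.
Proof.
move=> PQ; elim=> [|a y z Py _ Qz]; first by constructor.
by apply/generated_add => //; apply/generated_mul/PQ.
Qed.

Lemma generated_congr P x y : generated P (x - y) -> generated P x <-> generated P y.
Proof.
move=> Pxy; split=> [Px|Py]; last by rewrite -(subrK y x); apply: generated_add.
by rewrite -(subKr x y); apply: generated_sub.
Qed.

Definition ideal P : {pred R^o} := fun x => `[< generated P x >].

Lemma ideal_submod_closed P : submod_closed (ideal P).
Proof.
split=> [|a x y /asboolP Px /asboolP Py]; apply/asboolP; first by constructor.
by apply/generated_add => //; apply: generated_mul.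
Qed.
HB.instance Definition _ P :=
  GRing.isSubmodClosed.Build R R^o (ideal P) (ideal_submod_closed P).

Lemma idealP P x : reflect (generated P x) (x \in ideal P).
Proof. exact: asboolP. Qed.

Variable m : {pred R}.

Definition quot_depth_ge k P := depth_ge m k (quot_mod (ideal P)).

Lemma quot_depth_ge_cap k N S T U :
    (forall x, N x -> generated S x) -> (forall x, N x -> generated T x) ->
    (forall x, generated S x -> generated T x -> generated N x) ->
    (forall x, S x -> generated U x) -> (forall x, T x -> generated U x) ->
    (forall x, U x -> generated S x \/ generated T x) ->
    quot_depth_ge k S -> quot_depth_ge k T ->
  quot_depth_ge k.-1 U -> quot_depth_ge k N.
Proof.
move=> NS NT STN SU TU UST.
apply: depth_quot_cap => [x|x /idealP Sx|x /idealP Tx|x /idealP].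
- apply/idealP/andP => [Nx|[/idealP Sx /idealP Tx]]; last exact: STN.
  by split; apply/idealP; apply: generated_sub_in Nx.
- by apply/idealP; apply: generated_sub_in Sx.
- by apply/idealP; apply: generated_sub_in Tx.
elim=> [|a y z Uy _ [s /idealP Ss /idealP Ts]].
  by exists 0; [|rewrite subr0]; apply/idealP; constructor.
have [Sy|Ty] := UST _ Uy.
  exists (a * y + s); apply/idealP; first exact/generated_add/Ss/generated_mul.
  by rewrite opprD addrACA subrr add0r.
exists s; apply/idealP => //.
by rewrite -addrA; apply/generated_add/Ts/generated_mul.
Qed.

Lemma quot_depth_ge_regular k f P Q :
    f \in m -> (forall x, generated P (f * x) -> generated P x) ->
    (forall x, P x -> generated Q x) -> generated Q f ->
    (forall x, Q x -> exists y, generated P (x - f * y)) ->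
  quot_depth_ge k Q -> quot_depth_ge k.+1 P.
Proof.
move=> fm f_reg PQ Qf QP; apply: (depth_quot_regular fm) => x.
  by move=> /idealP/f_reg/idealP.
split=> [/idealP|[y /idealP Py]]; last first.
  apply/idealP; rewrite -(subrK (f * y) x); apply: generated_add.
    exact: generated_sub_in Py.
  by rewrite mulrC; apply: generated_mul.
elim=> [|a y z /QP[s Ps] _ [t /idealP Pt]].
  by exists 0; rewrite scaler0 subr0; apply/idealP; constructor.
exists (a * s + t); apply/idealP; rewrite -[_ *: _]/(f * _).
have -> : a * y + z - f * (a * s + t) = a * (y - f * s) + (z - f * t) by ring.
exact/generated_add/Pt/generated_mul.
Qed.
End GeneratedIdeal.

(** * Setting a variable to zero *)

Section KillVariable.
Variables (K : fieldType) (N : nat).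
Local Notation R := {mpoly K[N]}.
Implicit Types (k : 'I_N) (p q : R) (P : R -> Prop).

Definition kill k : R -> R :=
  comp_mpoly [tuple if i == k then 0 else 'X_i | i < N].
HB.instance Definition _ k := GRing.RMorphism.on (kill k).

Lemma killX k i : kill k 'X_i = if i == k then 0 else 'X_i.
Proof. by rewrite /kill comp_mpolyXU -tnth_nth tnth_mktuple. Qed.

Lemma kill_split k p : exists q, p = kill k p + 'X_k * q.
Proof.
have splitM p1 p2 : (exists q, p1 = kill k p1 + 'X_k * q) ->
    (exists q, p2 = kill k p2 + 'X_k * q) ->
    exists q, p1 * p2 = kill k (p1 * p2) + 'X_k * q.
  move=> [q1 e1] [q2 e2]; exists (q1 * p2 + kill k p1 * q2).
  by rewrite {1}e1 rmorphM /= {1}[X in _ * X]e2 {2}[in RHS]e2; ring.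
elim/mpolyind: p => [|c m p _ _ [q eq]].
  by exists 0; rewrite rmorph0 mulr0 addr0.
have [q' eq'] : exists q, 'X_[m] = kill k 'X_[m] + 'X_k * q.
  rewrite mpolyXE_id.
  apply: (big_ind (fun p : R => exists q, p = kill k p + 'X_k * q)) => //.
    by exists 0; rewrite rmorph1 mulr0 addr0.
  move=> i _; elim: (m i) => [|d IH].
    by exists 0; rewrite expr0 rmorph1 mulr0 addr0.
  rewrite exprS; apply: splitM => //; rewrite killX; case: eqP => [->|_].
    by exists 1; rewrite mulr1 add0r.
  by exists 0; rewrite mulr0 addr0.
exists (c *: q' + q).
rewrite {1}eq {1}eq' rmorphD /= [kill k (c *: _)]comp_mpolyZ -/(kill k _).
by rewrite scalerDr mulrDr scalerAr addrACA.
Qed.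

Lemma mpolyXk_neq0 k : 'X_k != 0 :> R.
Proof.
apply/eqP => /(congr1 (mcoeff U_(k))); rewrite mcoeffX eqxx mcoeff0.
by apply/eqP; rewrite oner_eq0.
Qed.

Definition avoids k P := forall q, P q -> kill k q = q.

(** If the variable k does not occur in the generators, the ideal is stable
   under killing it, and splitting off the multiples of the variable from a
   member of the ideal stays inside the ideal. *)
Lemma generated_kill k P q : avoids k P -> generated P q ->
  generated P (kill k q) /\
  exists2 q', generated P q' & q = kill k q + 'X_k * q'.
Proof.
move=> Pk; elim=> [|a y z Py _ [kz [z' Pz' ez]]].
  by rewrite rmorph0; split; [|exists 0; rewrite ?mulr0 ?addr0 //]; constructor.
have [a' ea] := kill_split k a.
rewrite rmorphD rmorphM /= (Pk y Py); split; first by constructor.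
exists (a' * y + z'); first by constructor.
by rewrite {1}ea {1}ez; ring.
Qed.

Lemma avoids_regular k P p : avoids k P ->
  generated P ('X_k * p) -> generated P p.
Proof.
move=> Pk /(generated_kill Pk)[_ [q Pq]].
rewrite rmorphM /= killX eqxx mul0r add0r.
by move=> /(mulfI (mpolyXk_neq0 k)) ->.
Qed.
End KillVariable.

(** * Binomial edge ideals with some variables added *)

Section EdgeIdeal.
Variables (K : fieldType) (n : nat).
Local Notation R := (bei_ring K n).
Local Notation x := (@bei_x K n).
Local Notation y := (@bei_y K n).
Local Notation f := (@bei_f K n).
Implicit Types (e : rel 'I_n) (A B C : {set 'I_n}) (v w : 'I_n).

(** Generators of J_e + (x_i, i in A) + (y_i, i in B).  The vertices of a graph
   that has lost some of them are those outside A and B. *)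
Inductive edge_gens e A B : R -> Prop :=
| edge_gen i j of e i j : edge_gens e A B (f i j)
| x_gen i of i \in A : edge_gens e A B (x i)
| y_gen i of i \in B : edge_gens e A B (y i).

Definition edge_ideal e A B := generated (edge_gens e A B).

Lemma f_anti i j : f i j = - f j i.
Proof. by rewrite /bei_f; ring. Qed.

Lemma f_diag i : f i i = 0.
Proof. by rewrite /bei_f; ring. Qed.

(** The determinant with rows x, x, y and columns v, w, i vanishes; expanded, it
   trades the edges at v for an edge at w. *)
Lemma f_exchange v w i : x w * f v i - x i * f v w = x v * f w i.
Proof. by rewrite /bei_f; ring. Qed.

Lemma edge_ideal_edge e A B i j : e i j -> edge_ideal e A B (f i j).
Proof. by move=> eij; apply/generated_in/edge_gen. Qed.
Lemma edge_ideal_x e A B i : i \in A -> edge_ideal e A B (x i).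
Proof. by move=> iA; apply/generated_in/x_gen. Qed.
Lemma edge_ideal_y e A B i : i \in B -> edge_ideal e A B (y i).
Proof. by move=> iB; apply/generated_in/y_gen. Qed.

Lemma edge_ideal_fA e A B i j : i \in A -> j \in A -> edge_ideal e A B (f i j).
Proof.
move=> iA jA; rewrite /bei_f; apply: generated_sub; rewrite mulrC;
by apply/generated_mul/edge_ideal_x.
Qed.

Lemma edge_ideal_fl e A B i j : i \in A -> i \in B -> edge_ideal e A B (f i j).
Proof.
move=> iA iB; rewrite /bei_f; apply: generated_sub; last exact/generated_mul/edge_ideal_y.
by rewrite mulrC; apply/generated_mul/edge_ideal_x.
Qed.

Lemma edge_ideal_fr e A B i j : j \in A -> j \in B -> edge_ideal e A B (f i j).
Proof. by move=> jA jB; rewrite f_anti; apply/generated_opp/edge_ideal_fl. Qed.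

Lemma kill_x v i : kill (lshift n v) (x i) = if i == v then 0 else x i.
Proof. by rewrite /bei_x killX (inj_eq (@lshift_inj _ _)). Qed.
Lemma kill_xy v i : kill (lshift n v) (y i) = y i.
Proof. by rewrite /bei_y killX eq_rlshift. Qed.
Lemma kill_y v i : kill (rshift n v) (y i) = if i == v then 0 else y i.
Proof. by rewrite /bei_y killX (inj_eq (@rshift_inj _ _)). Qed.
Lemma kill_yx v i : kill (rshift n v) (x i) = x i.
Proof. by rewrite /bei_x killX eq_lrshift. Qed.

Definition isolated e v := forall w, ~~ e v w && ~~ e w v.

Lemma isolatedl e v i j : isolated e v -> e i j -> (i == v) = false.
Proof. by move=> vi eij; apply/eqP => ei; have := vi j; rewrite -ei eij. Qed.
Lemma isolatedr e v i j : isolated e v -> e i j -> (j == v) = false.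
Proof. by move=> vi eij; apply/eqP => ej; have := vi i; rewrite -ej eij andbF. Qed.

Lemma avoids_x e A B v : v \notin A -> isolated e v ->
  avoids (lshift n v) (edge_gens e A B).
Proof.
move=> vA v_iso q [i j eij|i iA|i iB]; last by rewrite kill_xy.
  rewrite /bei_f rmorphB !rmorphM /= !kill_x !kill_xy.
  by rewrite (isolatedl v_iso eij) (isolatedr v_iso eij).
by rewrite kill_x; case: eqP iA vA => // -> ->.
Qed.

Lemma avoids_y e A B v : v \notin B -> isolated e v ->
  avoids (rshift n v) (edge_gens e A B).
Proof.
move=> vB v_iso q [i j eij|i iA|i iB]; first 1 last.
- by rewrite kill_yx.
- by rewrite kill_y; case: eqP iB vB => // -> ->.
rewrite /bei_f rmorphB !rmorphM /= !kill_y !kill_yx.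
by rewrite (isolatedl v_iso eij) (isolatedr v_iso eij).
Qed.

Lemma x_regular_isolated e A B v p : v \notin A -> isolated e v ->
  edge_ideal e A B (x v * p) -> edge_ideal e A B p.
Proof. by move=> vA v_iso; apply/avoids_regular/avoids_x. Qed.

Lemma y_regular_isolated e A B v p : v \notin B -> isolated e v ->
  edge_ideal e A B (y v * p) -> edge_ideal e A B p.
Proof. by move=> vB v_iso; apply/avoids_regular/avoids_y. Qed.

(** Deleted vertices remain as isolated ones, so that all graphs live on the
   same type. *)
Definition delete C e : rel 'I_n := fun i j => [&& e i j, i \notin C & j \notin C].

Lemma delete_isolated C e v : v \in C -> isolated (delete C e) v.
Proof. by move=> vC w; rewrite /delete vC !andbF. Qed.

(** * Cluster graphs *)

(** For symmetric irreflexive e: a disjoint union of complete graphs. *)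
Definition cluster e := forall v i j, e v i -> e v j -> i != j -> e i j.

Lemma delete_cluster C e : cluster e -> cluster (delete C e).
Proof.
move=> e_cl v i j /and3P[evi _ iC] /and3P[evj _ jC] ij.
by rewrite /delete iC jC (e_cl v).
Qed.

Lemma delete_sym C e : ssrbool.symmetric e -> ssrbool.symmetric (delete C e).
Proof. by move=> e_sym i j; rewrite /delete e_sym [(i \notin _) && _]andbC. Qed.

Lemma delete_irr C e : irreflexive e -> irreflexive (delete C e).
Proof. by move=> e_irr i; rewrite /delete e_irr. Qed.

(** Let w be a neighbour of v, let I' be the ideal of the graph without the edges
   at v, and suppose x_v p in I.  Modulo I', every edge f_vi at v satisfies
   x_w f_vi = x_i f_vw, so x_w x_v p is a multiple of f_vw.  Killing x_v, which
   does not occur in I', shows that the factor may be taken divisible by x_v,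
   whence x_w p = h f_vw modulo I'.  Reducing modulo the x_i with i a neighbour
   of v, where x_v and y_w become regular, shows that h is a combination of
   these x_i up to I'; by the same relation h f_vw is then x_w times an element
   of I modulo I', and x_w can be cancelled by induction. *)
Lemma cluster_x_regular e A B v p :
    ssrbool.symmetric e -> irreflexive e -> cluster e ->
    (forall i j, e i j -> (i \notin A) && (i \notin B)) -> v \notin A ->
  edge_ideal e A B (x v * p) -> edge_ideal e A B p.
Proof.
move: {2}#|_|.+1 (ltnSn #|[set w | e v w]|) => d.
elim: d => // d IHd in e v p * => + e_sym e_irr e_cl eAB vA.
rewrite ltnS => deg_v; have [w evw|ev0] := pickP (e v); last first.
  by apply: x_regular_isolated => // w; rewrite [e w v]e_sym !ev0.
set I := edge_ideal e A B.
have [vNw wA wB] : [/\ v != w, w \notin A & w \notin B].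
  have := eAB w v; rewrite e_sym evw => /(_ isT)/andP[-> ->].
  by case: eqP evw => // ->; rewrite e_irr.
have vB : v \notin B by have /andP[] := eAB _ _ evw.
pose e' := delete [set v] e; pose I' := edge_ideal e' A B.
have e'P i j : e' i j = [&& e i j, i != v & j != v] by rewrite /e' /delete !inE.
have e'_iso : isolated e' v by apply: delete_isolated; rewrite inE.
have I'_w q : I' (x w * q) -> I' q.
  apply: IHd => //; [|exact: delete_sym|exact: delete_irr|exact: delete_cluster|].
    apply: leq_trans deg_v; apply: proper_card; apply/properP; split.
      apply/subsetP => i; rewrite !inE e'P => /and3P[ewi _ iv].
      by apply: e_cl ewi _; rewrite 1?eq_sym // e_sym.
    by exists w; rewrite !inE // e'P e_irr.
  by move=> i j /and3P[/eAB].
have I'I q : I' q -> I q.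
  apply: generated_sub_in => _ [i j /and3P[eij _ _]|i iA|i iB].
  - exact: edge_ideal_edge.
  - exact: edge_ideal_x.
  - exact: edge_ideal_y.
have I'wf i : e v i -> I' (x v * f w i).
  move=> evi; apply: generated_mul; have [<-|wi] := eqVneq w i.
    by rewrite f_diag; constructor.
  apply: edge_ideal_edge; rewrite e'P (e_cl v) //= eq_sym vNw /=.
  by apply: contraTneq evi => ->; rewrite e_irr.
have elim_w q : I q -> exists h, I' (x w * q - h * f v w).
  elim=> [|a r z gr _ [h Ih]]; first by exists 0; rewrite mulr0 mul0r subr0; constructor.
  suff [h' Ih'] : exists h', I' (x w * r - h' * f v w).
    exists (a * h' + h).
    have -> : x w * (a * r + z) - (a * h' + h) * f v w =
       a * (x w * r - h' * f v w) + (x w * z - h * f v w) by ring.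
    exact/generated_add/Ih/generated_mul.
  have in_I' : I' r -> exists h', I' (x w * r - h' * f v w).
    by move=> Ir; exists 0; rewrite mul0r subr0; apply: generated_mul.
  case: gr in_I' => {r Ih}[i j eij|i iA|i iB] in_I'; last 2 first.
  - exact/in_I'/edge_ideal_x.
  - exact/in_I'/edge_ideal_y.
  have [iv|iv] := eqVneq i v.
    by rewrite iv in eij *; exists (x j); rewrite f_exchange; apply: I'wf.
  have [jv|jv] := eqVneq j v.
    rewrite jv in eij *; exists (- x i).
    rewrite f_anti mulrN mulNr -opprD; apply: generated_opp.
    by rewrite f_exchange; apply: I'wf; rewrite e_sym.
  by apply: in_I'; apply: edge_ideal_edge; rewrite e'P eij iv.
pose C := [set i | e v i]; pose I1 := edge_ideal (delete (v |: C) e) (A :|: C) B.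
have I'I1 q : I' q -> I1 q.
  apply: generated_sub_in => _ [i j|i iA|i iB]; last 2 first.
  - by apply: edge_ideal_x; rewrite inE iA.
  - exact: edge_ideal_y.
  rewrite e'P => /and3P[eij iv jv].
  have C_closed k l : e k l -> l != v -> k \in C -> l \in C.
    by rewrite !inE => ekl lv evk; apply: (e_cl k); rewrite // 1?e_sym // eq_sym.
  have [iC|iC] := boolP (i \in C).
    by apply: edge_ideal_fA; rewrite in_setU ?iC ?(C_closed _ _ eij jv iC) orbT.
  have [jC|jC] := boolP (j \in C).
    by rewrite e_sym in eij; rewrite (C_closed _ _ eij iv jC) in iC.
  by apply: edge_ideal_edge; rewrite /delete eij !in_setU1 (negPf iv) (negPf jv) iC jC.
have elim_C h : I1 h -> exists2 g, I g & I' (h * f v w - x w * g).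
  elim=> [|a r z gr _ [g Ig I'g]].
    by exists 0; rewrite ?mulr0 ?mul0r ?subr0; constructor.
  suff [g' Ig' I'g'] : exists2 g, I g & I' (r * f v w - x w * g).
    exists (a * g' + g); first exact/generated_add/Ig/generated_mul.
    have -> : (a * r + z) * f v w - x w * (a * g' + g) =
       a * (r * f v w - x w * g') + (z * f v w - x w * g) by ring.
    exact/generated_add/I'g/generated_mul.
  have in_I' : I' r -> exists2 g, I g & I' (r * f v w - x w * g).
    move=> Ir; exists 0; first by constructor.
    by rewrite mulr0 subr0 mulrC; apply: generated_mul.
  case: gr in_I' => {r}[i j /and3P[eij iC jC]|i iAC|i iB] in_I'.
  - apply: in_I'; apply: edge_ideal_edge; rewrite e'P eij.
    by rewrite !inE !negb_or in iC jC; case/andP: iC => ->; case/andP: jC => ->.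
  - move: iAC; rewrite !inE => /orP[iA|iC]; first exact/in_I'/edge_ideal_x.
    exists (f v i); first exact: edge_ideal_edge.
    by rewrite -opprB f_exchange; apply/generated_opp/I'wf.
  - exact/in_I'/edge_ideal_y.
move=> /elim_w[h Ih].
have [h' eh] := kill_split (lshift n v) h.
have {}Ih : I' (x w * p - h' * f v w).
  have I'h0 : I' (kill (lshift n v) h).
    have [+ _] := generated_kill (avoids_x vA e'_iso) Ih.
    rewrite rmorphB !rmorphM /= /bei_f rmorphB !rmorphM /= !kill_x !kill_xy.
    rewrite eqxx eq_sym (negPf vNw) => I'h0.
    apply/I'_w/(y_regular_isolated vB e'_iso).
    have -> : y v * (x w * kill (lshift n v) h) =
        x w * (0 * kill (lshift n v) p) - kill (lshift n v) h * (0 * y w - x w * y v) by ring.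
    exact: I'h0.
  apply: (x_regular_isolated vA e'_iso); rewrite -/I'.
  have -> : x v * (x w * p - h' * f v w) =
      (x w * (x v * p) - h * f v w) + f v w * kill (lshift n v) h.
    by rewrite {1}eh -/(x v); ring.
  exact/generated_add/generated_mul.
have I1h : I1 h'.
  have w_iso : isolated (delete (v |: C) e) w.
    by apply: delete_isolated; rewrite !inE evw orbT.
  have v_iso : isolated (delete (v |: C) e) v.
    by apply: delete_isolated; rewrite !inE eqxx.
  apply: (y_regular_isolated wB w_iso).
  apply: (x_regular_isolated _ v_iso); first by rewrite !inE negb_or vA e_irr.
  have -> : x v * (y w * h') = (h' * y v + p) * x w - (x w * p - h' * f v w).
    by rewrite /bei_f; ring.
  apply: generated_sub; last exact: I'I1.
  by apply/generated_mul/edge_ideal_x; rewrite !inE evw orbT.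
have [g Ig I'g] := elim_C _ I1h.
rewrite -/I; apply/(generated_congr _)/Ig; apply/I'I/I'_w.
rewrite mulrBr -[X in X - _](subrK (h' * f v w)) -addrA.
exact: generated_add.
Qed.
End EdgeIdeal.

Section EdgeIdealDepth.
Variables (K : fieldType) (n : nat).
Local Notation R := (bei_ring K n).
Local Notation x := (@bei_x K n).
Local Notation y := (@bei_y K n).
Local Notation f := (@bei_f K n).
Implicit Types (e : rel 'I_n) (A B C S U : {set 'I_n}) (v w : 'I_n).

Definition edge_depth_ge k e A B :=
  quot_depth_ge (@max_ideal K n) k (edge_gens e A B).

Lemma max_ideal_var (i : 'I_(n + n)) : ('X_i : R) \in @max_ideal K n.
Proof.
apply/asboolP; exists (fun j => (j == i)%:R).
rewrite (bigD1 i) //= eqxx mul1r big1 ?addr0 // => j /negPf ->.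
by rewrite mul0r.
Qed.

Lemma edge_depth_x k e A B v :
    (forall p, edge_ideal e A B (x v * p) -> edge_ideal e A B p) ->
  edge_depth_ge k e (v |: A) B -> edge_depth_ge k.+1 e A B.
Proof.
move=> x_reg; apply: quot_depth_ge_regular x_reg _ _ _.
- exact: max_ideal_var.
- move=> _ [i j eij|i iA|i iB].
  + exact: edge_ideal_edge.
  + by apply: edge_ideal_x; rewrite inE iA orbT.
  + exact: edge_ideal_y.
- by apply: edge_ideal_x; rewrite !inE eqxx.
- move=> _ [i j eij|i|i iB].
  + by exists 0; rewrite mulr0 subr0; apply: edge_ideal_edge.
  + rewrite !inE => /predU1P[->|iA].
      by exists 1; rewrite mulr1 subrr; constructor.
    by exists 0; rewrite mulr0 subr0; apply: edge_ideal_x.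
  + by exists 0; rewrite mulr0 subr0; apply: edge_ideal_y.
Qed.

Lemma edge_depth_y k e A B v :
    (forall p, edge_ideal e A B (y v * p) -> edge_ideal e A B p) ->
  edge_depth_ge k e A (v |: B) -> edge_depth_ge k.+1 e A B.
Proof.
move=> y_reg; apply: quot_depth_ge_regular y_reg _ _ _.
- exact: max_ideal_var.
- move=> _ [i j eij|i iA|i iB].
  + exact: edge_ideal_edge.
  + exact: edge_ideal_x.
  + by apply: edge_ideal_y; rewrite inE iB orbT.
- by apply: edge_ideal_y; rewrite !inE eqxx.
- move=> _ [i j eij|i iA|i].
  + by exists 0; rewrite mulr0 subr0; apply: edge_ideal_edge.
  + by exists 0; rewrite mulr0 subr0; apply: edge_ideal_x.
  + rewrite !inE => /predU1P[->|iB].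
      by exists 1; rewrite mulr1 subrr; constructor.
    by exists 0; rewrite mulr0 subr0; apply: edge_ideal_y.
Qed.

(** If C is the clique of v, then I + (x_v) is the intersection of the ideals in
   which all x_i for i in C, respectively x_v and y_v, are set to zero: a member
   of the second one is y_v q modulo I + (x_v); y_v can be cancelled modulo the
   first ideal, and y_v x_i = x_v y_i modulo I. *)
Lemma edge_depth_cluster_x k e A B v :
    ssrbool.symmetric e -> cluster e -> v \notin B ->
  let C := v |: [set i | e v i] in
    edge_depth_ge k (delete C e) (C :|: A) B ->
    edge_depth_ge k (delete [set v] e) (v |: A) (v |: B) ->
    edge_depth_ge k.-1 (delete C e) (C :|: A) (v |: B) ->
  edge_depth_ge k e (v |: A) B.
Proof.
move=> e_sym e_cl vB C.
have C_closed i j : e i j -> i \in C -> j \in C.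
  rewrite !inE => eij /predU1P[<-|evi]; first by rewrite eij orbT.
  case: eqVneq => //= jv; apply: (e_cl i); rewrite // 1?e_sym //.
  by rewrite eq_sym.
have C_vars i j B' : e i j -> edge_ideal (delete C e) (C :|: A) B' (f i j).
  move=> eij; have [iC|iC] := boolP (i \in C).
    by apply: edge_ideal_fA; rewrite in_setU ?iC ?(C_closed _ _ eij iC).
  apply: edge_ideal_edge; rewrite /delete eij iC /=.
  by apply: contraNN iC; apply: C_closed; rewrite e_sym.
have vC : v \in C by rewrite !inE eqxx.
have vAC i : i \in v |: A -> i \in C :|: A.
  by rewrite in_setU1 [i \in C :|: A]in_setU => /predU1P[->|->]; rewrite ?vC ?orbT.
pose N := @edge_ideal K n e (v |: A) B.
move=> dS dT dU; apply: quot_depth_ge_cap dS dT dU.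
- move=> _ [i j eij|i iA|i iB]; [exact: C_vars| |exact: edge_ideal_y].
  exact/edge_ideal_x/vAC.
- move=> _ [i j eij|i iA|i iB].
  + have [->|iv] := eqVneq i v.
      by apply: edge_ideal_fl; rewrite !inE eqxx.
    have [->|jv] := eqVneq j v.
      by apply: edge_ideal_fr; rewrite !inE eqxx.
    by apply: edge_ideal_edge; rewrite /delete eij !in_set1 iv jv.
  + exact: edge_ideal_x.
  + by apply: edge_ideal_y; rewrite inE iB orbT.
- move=> p pS pT.
  have [q Nq] : exists q, N (p - y v * q).
    elim: pT => [|a r z gr _ [q Nq]].
      by exists 0; rewrite mulr0 subr0; constructor.
    suff [q' Nq'] : exists q, N (r - y v * q).
      exists (a * q' + q).
      have -> : a * r + z - y v * (a * q' + q) =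
        a * (r - y v * q') + (z - y v * q) by ring.
      exact/generated_add/Nq/generated_mul.
    have in_N : N r -> exists q, N (r - y v * q).
      by move=> Nr; exists 0; rewrite mulr0 subr0.
    case: gr in_N => {r}[i j /and3P[eij _ _]|i iA|i iB] in_N.
    + exact/in_N/edge_ideal_edge.
    + exact/in_N/edge_ideal_x.
    + move: iB; rewrite inE in_set1 => /predU1P[->|iB]; last exact/in_N/edge_ideal_y.
      by exists 1; rewrite mulr1 subrr; constructor.
  have NS r : N r -> edge_ideal (delete C e) (C :|: A) B r.
    apply: generated_sub_in => {r} _ [i j eij|i|i iB]; first exact: C_vars.
      by move=> /vAC; apply: edge_ideal_x.
    exact: edge_ideal_y.
  have Sq : edge_ideal (delete C e) (C :|: A) B q.
    apply: (y_regular_isolated vB (delete_isolated e vC)).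
    by rewrite -[_ * q](subKr p); apply: generated_sub pS _; apply: NS.
  suff Nyq : N (y v * q) by apply/(generated_congr Nq).
  elim: Sq => [|a r z gr _ IH]; first by rewrite mulr0; constructor.
  rewrite mulrDr mulrCA; apply: generated_add => //; apply: generated_mul.
  case: gr => {r IH}[i j /and3P[eij _ _]|i|i iB].
  + exact/generated_mul/edge_ideal_edge.
  + rewrite in_setU => /orP[|iA]; last first.
      by apply/generated_mul/edge_ideal_x; rewrite inE iA orbT.
    rewrite in_setU1 inE => /predU1P[->|evi].
      by apply/generated_mul/edge_ideal_x; rewrite !inE eqxx.
    have -> : y v * x i = y i * x v - f v i by rewrite /bei_f; ring.
    apply: generated_sub; last exact: edge_ideal_edge.
    by apply/generated_mul/edge_ideal_x; rewrite !inE eqxx.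
  + exact/generated_mul/edge_ideal_y.
- move=> _ [i j eij|i iA|i iB].
  + exact: edge_ideal_edge.
  + exact: edge_ideal_x.
  + by apply: edge_ideal_y; rewrite inE iB orbT.
- move=> _ [i j /and3P[eij _ _]|i iA|i iB]; [exact: C_vars| |exact: edge_ideal_y].
  exact/edge_ideal_x/vAC.
- move=> _ [i j eij|i iA|i].
  + by left; apply: edge_ideal_edge.
  + by left; apply: edge_ideal_x.
  + rewrite in_setU1 => /predU1P[->|iB].
      by right; apply: edge_ideal_y; rewrite !inE eqxx.
    by left; apply: edge_ideal_y.
Qed.

(** A clique of size r contributes r variables y_i and at most one element of S;
   r + 1 is the depth of the quotient by the 2-minors of a generic 2 x r matrix.
   The induction sets variables to zero one after the other, and S can retain a
   vertex in each clique whose variables x_i are not yet all zero. *)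
Lemma cluster_depth e A B S :
    ssrbool.symmetric e -> irreflexive e -> cluster e ->
    (forall i j, e i j -> (i \notin A) && (i \notin B)) ->
    S \subset ~: A -> {in S &, forall i j, ~~ e i j} ->
  edge_depth_ge (#|~: B| + #|S|) e A B.
Proof.
move: {2}(#|_| + #|_|).+1 (ltnSn (#|~: A| + #|~: B|)) => d.
elim: d => // d IHd in e A B S * => + e_sym e_irr e_cl eAB SA S_ind.
rewrite ltnS => size_d.
have card_setC1U (D : {set 'I_n}) v : v \notin D -> #|~: D| = #|~: (v |: D)|.+1.
  move=> vD; rewrite (cardsD1 v (~: D)) inE vD add1n; congr _.+1.
  by apply: eq_card => i; rewrite !inE negb_or.
have [v | Afull] := pickP (mem (~: A)); last first.
  have -> : S = set0.
    apply/setP => i; rewrite inE; apply/negP => /(subsetP SA).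
    by rewrite -[_ \in _]/(mem (~: A) i) Afull.
  have e0 v : isolated e v.
    move=> w; apply/andP; split; apply/negP => /eAB/andP[vA _];
    by have := Afull v; have := Afull w; rewrite /= !inE vA.
  have [v | Bfull] := pickP (mem (~: B)); last first.
    by move=> N _ i; rewrite (eq_card0 Bfull) cards0.
  rewrite /= inE => vB; rewrite (card_setC1U _ _ vB) addSn.
  apply: (edge_depth_y (v := v)).
    by move=> p; apply: y_regular_isolated.
  apply: IHd => //.
  - by rewrite (card_setC1U _ _ vB) addnS in size_d.
  - by move=> i j eij; have := e0 i j; rewrite eij.
  - exact: sub0set.
  - by move=> i j; rewrite inE.
rewrite /= inE => vA.
apply: (@depth_ge_leq _ _ (#|~: B| + #|S|).-1.+1); first exact: leqSpred.
apply: (edge_depth_x (v := v)) => [p|]; first exact: cluster_x_regular.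
have [w evw|ev0] := pickP (e v); last first.
  have v_iso : isolated e v by move=> w; rewrite [e w v]e_sym !ev0.
  apply: (@depth_ge_leq _ _ (#|~: B| + #|S :\ v|)).
    by rewrite (cardsD1 v S); case: (_ \in _) => /=; lia.
  apply: IHd => //.
  - by rewrite (card_setC1U _ _ vA) in size_d.
  - move=> i j eij; rewrite in_setU1 negb_or (isolatedl v_iso eij) /=.
    exact: eAB eij.
  - apply/subsetP => i; rewrite !inE negb_or => /andP[-> iS].
    by have := subsetP SA _ iS; rewrite inE.
  - by move=> i j; rewrite !inE => /andP[_ iS] /andP[_ jS]; apply: S_ind.
have vB : v \notin B by have /andP[] := eAB _ _ evw.
have card_S : (#|S| <= #|S :\: (v |: [set i | e v i])|.+1)%N.
  rewrite -(cardsID (v |: [set i | e v i]) S) -add1n leq_add2r.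
  rewrite leqNgt; apply/card_gt1P => -[i [j []]].
  rewrite !inE => /andP[iS iC] /andP[jS jC] ij.
  have /negP[] := S_ind _ _ iS jS.
  case/predU1P: iC ij => [->|evi]; case/predU1P: jC => [->|evj] ij.
  + by rewrite eqxx in ij.
  + by [].
  + by rewrite e_sym.
  + exact: e_cl evi evj ij.
have S_sub (D D' : {set 'I_n}) : D' \subset S -> [disjoint D & D'] -> D' \subset ~: (D :|: A).
  move=> D'S DD'; apply/subsetP => i iD'; rewrite !inE negb_or.
  have := subsetP SA _ (subsetP D'S _ iD'); rewrite inE => ->.
  by rewrite (disjointFl DD' iD').
set C := v |: [set i | e v i] in card_S *.
have C_disj : [disjoint C & S :\: C].
  by rewrite -setI_eq0; apply/eqP/setP => i; rewrite !inE; case: (_ || _).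
have small : (#|~: (C :|: A)| < #|~: A|)%N.
  apply: proper_card; apply/properP; split.
    by apply/subsetP => i; rewrite !inE negb_or => /andP[].
  by exists v; rewrite !inE ?eqxx.
have IHC B' : (#|~: B'| <= #|~: B|)%N ->
    (forall i j, e i j -> i \notin C -> i \notin B') ->
    edge_depth_ge (#|~: B'| + #|S :\: C|) (delete C e) (C :|: A) B'.
  move=> B'B eB'; apply: IHd.
  - by apply: leq_trans size_d; rewrite -addSn leq_add.
  - exact: delete_sym.
  - exact: delete_irr.
  - exact: delete_cluster.
  - move=> i j /and3P[eij iC _]; rewrite in_setU negb_or iC (eB' i j) //.
    by have /andP[->] := eAB _ _ eij.
  - by apply: S_sub => //; apply: subsetDl.
  - move=> i j; rewrite !inE => /andP[_ iS] /andP[_ jS].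
    by rewrite /delete negb_and (S_ind i j).
apply: edge_depth_cluster_x => //; rewrite -/C.
- apply: (depth_ge_leq _ (IHC B _ _)) => //; first by lia.
  by move=> i j /eAB/andP[].
- (* w takes the place of v. *)
  pose S' := if v \in S then w |: (S :\ v) else S.
  have vS' : v \notin S'.
    rewrite /S'; case: ifP => [_|-> //].
    by rewrite !inE eqxx orbF; apply: contraTneq evw => ->; rewrite e_irr.
  have ewS i : v \in S -> i \in S -> i != v -> ~~ e w i.
    move=> vS iS iv; apply/negP => ewi; have /negP[] := S_ind _ _ vS iS.
    by apply: (e_cl w); rewrite // 1?e_sym // eq_sym.
  apply: (@depth_ge_leq _ _ (#|~: (v |: B)| + #|S'|)).
    rewrite (card_setC1U _ _ vB) /S'; case: ifP => vS; last by rewrite addSn.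
    rewrite cardsU1 (cardsD1 v S) vS addSn inE.
    have -> /= : w \in S = false.
      by apply/negP => wS; have := S_ind _ _ vS wS; rewrite evw.
    by rewrite in_set1 andbF /= add1n.
  apply: IHd => //.
  + by move: size_d; rewrite (card_setC1U _ _ vA) (card_setC1U _ _ vB) addSn addnS => /ltnW.
  + exact: delete_sym.
  + exact: delete_irr.
  + exact: delete_cluster.
  + move=> i j /and3P[eij]; rewrite !inE !negb_or => -> _ /=.
    exact: eAB eij.
  + apply/subsetP => i iS'; rewrite !inE negb_or.
    rewrite (contraTneq _ iS') => [|->] //=.
    move: iS'; rewrite /S'; case: ifP => _; last first.
      by move/(subsetP SA); rewrite inE.
    rewrite !inE => /predU1P[->|/andP[_ /(subsetP SA)]]; last by rewrite inE.
    by have /andP[] : (w \notin A) && (w \notin B) by apply: (eAB w v); rewrite e_sym.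
  + move=> i j iS' jS'; rewrite /delete negb_and; apply/orP; left.
    move: iS' jS'; rewrite /S'; case: ifP => [vS|_]; last exact: S_ind.
    rewrite !inE => /predU1P[->|/andP[iv iS]] /predU1P[->|/andP[jv jS]].
    * by rewrite e_irr.
    * exact: ewS.
    * by rewrite e_sym ewS.
    * exact: S_ind.
- apply: (depth_ge_leq _ (IHC (v |: B) _ _)).
  + by rewrite (card_setC1U _ _ vB) addSn /= -subn1 leq_subLR addnCA leq_add2l add1n.
  + by rewrite (card_setC1U _ _ vB).
  + move=> i j /eAB/andP[_ iB] iC; rewrite in_setU1 negb_or iB andbT.
    by apply: contraNneq iC => ->; rewrite !inE eqxx.
Qed.

(** * Completing a neighbourhood *)

(** The graph G_v. *)
Definition complete v e : rel 'I_n :=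
  fun i j => e i j || [&& i != j, e v i & e v j].

Lemma f_exchange_y v w i : y w * f v i - y i * f v w = y v * f w i.
Proof. by rewrite /bei_f; ring. Qed.

(** Killing x_v and y_v maps (x_v, y_v) + J_(G - v) into J_G, and changes a
   member of J_(G_v) only by a member of J_G, because x_v f_ij and y_v f_ij lie
   in J_G for i and j adjacent to v.  This identifies the intersection. *)
Lemma edge_depth_complete k e U v :
    ssrbool.symmetric e -> irreflexive e ->
    (forall i j, e i j -> i \notin U) -> v \notin U ->
    edge_depth_ge k (complete v e) U U ->
    edge_depth_ge k (delete [set v] e) (v |: U) (v |: U) ->
    edge_depth_ge k.-1 (delete [set v] (complete v e)) (v |: U) (v |: U) ->
  edge_depth_ge k e U U.
Proof.
move=> e_sym e_irr eU vU.
have inU i : i \in U -> i \in v |: U by move=> iU; rewrite inE iU orbT.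
have inv : v \in v |: U by rewrite !inE eqxx.
have sub_del e1 i j : e1 i j ->
    edge_ideal (delete [set v] e1) (v |: U) (v |: U) (f i j).
  move=> eij; have [->|iv] := eqVneq i v; first exact: edge_ideal_fl.
  have [->|jv] := eqVneq j v; first exact: edge_ideal_fr.
  by apply: edge_ideal_edge; rewrite /delete eij !in_set1 iv jv.
pose N := @edge_ideal K n e U U.
pose kk (p : R) : R := kill (lshift n v) (kill (rshift n v) p).
have kkM p q : kk (p * q) = kk p * kk q by rewrite /kk !rmorphM.
have kkD p q : kk (p + q) = kk p + kk q by rewrite /kk !rmorphD.
have kkB p q : kk (p - q) = kk p - kk q by rewrite /kk !rmorphB.
have kk0 : kk 0 = 0 by rewrite /kk !rmorph0.
have kkx i : kk (x i) = if i == v then 0 else x i.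
  by rewrite /kk kill_yx kill_x.
have kky i : kk (y i) = if i == v then 0 else y i.
  by rewrite /kk kill_y; case: ifP => _; rewrite ?rmorph0 // kill_xy.
have kkf i j : i != v -> j != v -> kk (f i j) = f i j.
  by move=> /negPf iv /negPf jv; rewrite /bei_f kkB !kkM !kkx !kky iv jv.
have kk_split p : exists b c, p - kk p = x v * c + y v * b.
  have [b eb] := kill_split (rshift n v) p.
  have [c ec] := kill_split (lshift n v) (kill (rshift n v) p).
  by exists b, c; rewrite {1}eb {1}ec /kk /bei_x /bei_y; ring.
have N_kk p : edge_ideal (complete v e) U U p -> N (p - kk p).
  elim=> [|a r z gr _ Nz]; first by rewrite kk0 subrr; constructor.
  have -> : a * r + z - kk (a * r + z) =
      (a - kk a) * r + kk a * (r - kk r) + (z - kk z).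
    by rewrite kkD kkM; ring.
  apply: generated_add Nz; apply: generated_add.
    have [b [c ->]] := kk_split a.
    have [Nx Ny] : N (x v * r) /\ N (y v * r).
      case: gr => [i j|i iU|i iU].
      - case/orP=> [eij|/and3P[_ evi evj]].
          by split; apply/generated_mul/edge_ideal_edge.
        rewrite -f_exchange -f_exchange_y.
        by split; apply: generated_sub; apply/generated_mul/edge_ideal_edge.
      - by split; apply/generated_mul/edge_ideal_x.
      - by split; apply/generated_mul/edge_ideal_y.
    have -> : (x v * c + y v * b) * r = c * (x v * r) + b * (y v * r) by ring.
    by apply: generated_add; apply: generated_mul.
  apply: generated_mul.
  have neqU i : i \in U -> (i == v) = false.
    by move=> iU; apply: contraNF vU => /eqP <-.
  case: gr => {r}[i j eij|i iU|i iU].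
  - have [iv|iv] := eqVneq i v.
      rewrite iv in eij *; apply: generated_sub.
        by apply: edge_ideal_edge; case/orP: eij => // /and3P[]; rewrite e_irr.
      by rewrite /bei_f kkB !kkM !kkx !kky eqxx !mul0r mulr0 subrr; constructor.
    have [jv|jv] := eqVneq j v.
      rewrite jv in eij *; apply: generated_sub.
        by apply: edge_ideal_edge; case/orP: eij => // /and3P[]; rewrite e_irr.
      by rewrite /bei_f kkB !kkM !kkx !kky eqxx !mul0r mulr0 subrr; constructor.
    by rewrite kkf // subrr; constructor.
  - by rewrite kkx neqU // subrr; constructor.
  - by rewrite kky neqU // subrr; constructor.
have kk_N p : edge_ideal (delete [set v] e) (v |: U) (v |: U) p -> N (kk p).
  elim=> [|a r z gr _ Nz]; first by rewrite kk0; constructor.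
  rewrite kkD kkM; apply: generated_add Nz; apply: generated_mul.
  case: gr => {r}[i j|i|i].
  - rewrite /delete !in_set1 => /and3P[eij iv jv].
    by rewrite kkf //; apply: edge_ideal_edge.
  - rewrite kkx in_setU1; case: eqP => [_ _|_ iU]; first by constructor.
    exact: edge_ideal_x.
  - rewrite kky in_setU1; case: eqP => [_ _|_ iU]; first by constructor.
    exact: edge_ideal_y.
move=> dS dT dU; apply: quot_depth_ge_cap dS dT dU.
- move=> _ [i j eij|i iU|i iU]; [|exact: edge_ideal_x|exact: edge_ideal_y].
  by apply: edge_ideal_edge; rewrite /complete eij.
- move=> _ [i j eij|i iU|i iU]; first exact: sub_del.
  + exact/edge_ideal_x/inU.
  + exact/edge_ideal_y/inU.
- move=> p /N_kk + /kk_N Nkp => Np.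
  by rewrite -(subrK (kk p) p); apply: generated_add.
- move=> _ [i j eij|i iU|i iU]; first exact: sub_del.
  + exact/edge_ideal_x/inU.
  + exact/edge_ideal_y/inU.
- move=> _ [i j /and3P[eij iv jv]|i iU|i iU].
  + by apply: edge_ideal_edge; rewrite /delete /complete eij iv jv.
  + exact: edge_ideal_x.
  + exact: edge_ideal_y.
- move=> _ [i j /and3P[eij _ _]|i iU|i iU].
  + by left; apply: edge_ideal_edge.
  + by right; apply: edge_ideal_x.
  + by right; apply: edge_ideal_y.
Qed.
End EdgeIdealDepth.

(** * Walks *)

Section Walks.
Variable n : nat.
Local Notation T := 'I_n.
Implicit Types (e : rel T) (u v w : T) (l : nat) (U : {set T}).
Local Open Scope nat_scope.

Inductive walk e : T -> T -> nat -> Prop :=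
| walk_nil u : walk e u u 0
| walk_cons u v w l : e u v -> walk e v w l -> walk e u w l.+1.

Lemma walkE e u w l : walk e u w l ->
  if l is l'.+1 then exists2 v, e u v & walk e v w l' else u = w.
Proof. by case=> // {}u v {}w {}l euv vw; exists v. Qed.

Lemma walk_cat e u v w l l' :
  walk e u v l -> walk e v w l' -> walk e u w (l + l').
Proof.
elim=> [//|{}u u' {}v {}l euu' _ IH vw]; rewrite addSn.
exact: walk_cons (IH vw).
Qed.

Lemma walk_rcons e u v w l : walk e u v l -> e v w -> walk e u w l.+1.
Proof.
move=> uv evw; rewrite -addn1; apply: walk_cat uv _.
exact/walk_cons/walk_nil.
Qed.

Lemma walk_sym e u v l : ssrbool.symmetric e -> walk e u v l -> walk e v u l.
Proof.
move=> e_sym; elim=> [w|{}u u' {}v {}l euu' _ IH]; first exact: walk_nil.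
by apply: walk_rcons IH _; rewrite e_sym.
Qed.

Lemma path_walk e u p : path e u p -> walk e u (last u p) (size p).
Proof.
elim: p u => [|v p IH] u /=; first by move=> _; apply: walk_nil.
by case/andP=> euv /IH; apply: walk_cons.
Qed.

Lemma walk_connect e u v l : walk e u v l -> connect e u v.
Proof.
elim=> [w|{}u u' {}v {}l euu' _]; first exact: connect0.
exact/connect_trans/connect1.
Qed.

Lemma connect_walk e u v : connect e u v -> exists l, walk e u v l.
Proof. by case/connectP=> p /path_walk + -> => up; exists (size p). Qed.

Lemma walk_sub e e' u v l : subrel e e' -> walk e u v l -> walk e' u v l.
Proof.
move=> ee'; elim=> [w|{}u u' {}v {}l /ee' euu' _ IH]; first exact: walk_nil.
exact: walk_cons IH.
Qed.

Lemma connect_subrel e e' u v : subrel e e' -> connect e u v -> connect e' u v.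
Proof. by move=> ee'; apply: connect_sub => i j /ee'; apply: connect1. Qed.

Lemma walk_path_points e u v l : walk e u v l ->
  exists P : nat -> T, [/\ P 0 = u, P l = v & forall i, i < l -> e (P i) (P i.+1)].
Proof.
elim=> [w|{}u u' {}v {}l euu' _ [P [P0 Pl Pe]]].
  by exists (fun=> w).
exists (fun i => if i is j.+1 then P j else u); split=> // -[|i] il.
  by rewrite P0.
exact: Pe.
Qed.

(** * Free vertices under deletion and completion *)

Lemma free_vertexP e v :
  reflect (forall a b, e v a -> e v b -> a != b -> e a b) (free_vertex e v).
Proof.
apply: (iffP forallP) => [fv a b eva evb ab|fv a].
  by have /forallP/(_ b) := fv a; rewrite eva evb ab.
by apply/forallP => b; apply/implyP => /and3P[]; apply: fv.
Qed.

Lemma nonfreeP e v : ~~ free_vertex e v ->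
  exists a b, [/\ e v a, e v b, a != b & ~~ e a b].
Proof.
move/forallPn=> [a /forallPn[b]]; rewrite negb_imply => /andP[/and3P[eva evb ab] eab].
by exists a, b.
Qed.

Lemma free_delete (C : {set T}) e u :
  free_vertex e u -> free_vertex (delete C e) u.
Proof.
move=> /free_vertexP fu; apply/free_vertexP => a b.
by move=> /and3P[eua _ aC] /and3P[eub _ bC] ab; rewrite /delete aC bC fu.
Qed.

Lemma free_deleted (C : {set T}) e u : u \in C -> free_vertex (delete C e) u.
Proof. by move=> uC; apply/free_vertexP => a b; rewrite /delete uC andbF. Qed.

Lemma complete_sym v e : ssrbool.symmetric e -> ssrbool.symmetric (complete v e).
Proof.
by move=> e_sym i j; rewrite /complete e_sym eq_sym [e v i && _]andbC.
Qed.

Lemma complete_irr v e : irreflexive e -> irreflexive (complete v e).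
Proof. by move=> e_irr i; rewrite /complete e_irr eqxx. Qed.

Lemma sub_complete v e : subrel e (complete v e).
Proof. by move=> i j eij; rewrite /complete eij. Qed.

Lemma free_complete v e u : ssrbool.symmetric e ->
  free_vertex e u -> free_vertex (complete v e) u.
Proof.
move=> e_sym /free_vertexP fu; apply/free_vertexP => a b ua ub ab.
have new c d : e u c -> e v u -> e v d -> c != d -> complete v e c d.
  move=> euc evu evd cd; have [->|cv] := eqVneq c v; first by rewrite /complete evd.
  by rewrite /complete cd evd (fu v c) ?orbT // 1?e_sym // eq_sym.
case/orP: ua => [eua|/and3P[_ evu eva]]; case/orP: ub => [eub|/and3P[_ evu' evb]].
- by rewrite /complete fu.
- exact: new.
- by rewrite complete_sym // new // eq_sym.
- by rewrite /complete ab eva evb orbT.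
Qed.

Lemma free_completed v e : irreflexive e -> free_vertex (complete v e) v.
Proof.
move=> e_irr; apply/free_vertexP => a b; rewrite /complete !e_irr !andbF !orbF.
by move=> -> -> ->; rewrite orbT.
Qed.

Definition alive_free e U := #|[set v in ~: U | free_vertex e v]|.
Definition nonfree e := #|[set v | ~~ free_vertex e v]|.

Lemma nonfree_lt e e' v : (forall u, free_vertex e u -> free_vertex e' u) ->
  ~~ free_vertex e v -> free_vertex e' v -> nonfree e' < nonfree e.
Proof.
move=> ee' nfv fv; apply: proper_card; apply/properP; split.
  by apply/subsetP => u; rewrite !inE; apply: contraNN; apply: ee'.
by exists v; rewrite !inE ?nfv // negbK.
Qed.

Lemma alive_free_delete e U v : (forall i j, e i j -> i \notin U) ->
    (forall u, free_vertex e u -> u != v) ->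
  forall e', (forall u, free_vertex e u -> free_vertex e' u) ->
  alive_free e U <= alive_free e' (v |: U).
Proof.
move=> eU fv e' ee'; apply/subset_leq_card/subsetP => u.
rewrite !inE negb_or => /andP[uU fu].
by rewrite uU fv // ee'.
Qed.

Lemma alive_free_lt e e' U U' z :
    (forall u, u \notin U -> free_vertex e u -> (u \notin U') && free_vertex e' u) ->
    ~~ free_vertex e z -> z \notin U' -> free_vertex e' z ->
  alive_free e U < alive_free e' U'.
Proof.
move=> sub nfz zU' fz; apply: proper_card; apply/properP; split.
  by apply/subsetP => u; rewrite !inE => /andP[uU fu]; apply: sub.
by exists z; rewrite !inE ?zU' ?fz // (negPf nfz) andbF.
Qed.

(** * Distances under deletion and completion *)

Lemma delete1E v e i j :
  delete [set v] e i j = [&& e i j, i != v & j != v].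
Proof. by rewrite /delete !in_set1. Qed.

Lemma sub_delete C e : subrel (delete C e) e.
Proof. by move=> i j /and3P[]. Qed.

Lemma connect_complete v e u w : ssrbool.symmetric e ->
  connect (complete v e) u w = connect e u w.
Proof.
move=> e_sym; apply/idP/idP; last exact/connect_subrel/sub_complete.
apply: connect_sub => i j /orP[|/and3P[_ evi evj]]; first exact: connect1.
by apply: connect_trans (connect1 evj); apply: connect1; rewrite e_sym.
Qed.

Definition reach e u w l := exists2 l', l' <= l & walk e u w l'.

Lemma reach_rcons e u v w l : reach e u v l -> e v w -> reach e u w l.+1.
Proof. by move=> [l' l'l uv] evw; exists l'.+1 => //; apply: walk_rcons uv evw. Qed.

Lemma reachS e u w l : reach e u w l -> reach e u w l.+1.
Proof. by move=> [l' l'l uw]; exists l' => //; apply: leqW. Qed.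

(** A walk may use several of the new edges, but from the first one on v itself
   is within reach, so that the delay never exceeds one step. *)
Lemma walk_complete v e u w l : ssrbool.symmetric e ->
    walk (complete v e) u w l ->
  reach e u w l \/ reach e u v l /\ reach e u w l.+1.
Proof.
move=> e_sym /(walk_sym (complete_sym v e_sym)).
elim=> {w l u}[a|b a c l].
  by left; exists 0 => //; apply: walk_nil.
rewrite (complete_sym v e_sym) => + _ IH; case/orP=> [eab|/and3P[_ eva evb]].
  case: IH => [ca|[cv ca]]; first by left; apply: reach_rcons eab.
  by right; split; [apply: reachS|apply: reach_rcons eab].
case: IH => [ca|[cv ca]].
  have cv : reach e c v l.+1 by apply: reach_rcons ca _; rewrite e_sym.
  by right; split=> //; apply: reach_rcons evb.
by left; apply: reach_rcons cv evb.
Qed.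

(** A passage through v is replaced by the edge between its two neighbours. *)
Lemma connect_delete_complete v e u w : ssrbool.symmetric e -> irreflexive e ->
  connect e u w -> u != v -> w != v -> connect (delete [set v] (complete v e)) u w.
Proof.
move=> e_sym e_irr /connect_walk[l /(walk_sym e_sym) wu] uv.
suff [+ _] : (w != v -> connect (delete [set v] (complete v e)) u w) /\
    (w = v -> forall a, e v a -> a != v ->
              connect (delete [set v] (complete v e)) u a) by [].
elim: wu uv => {w u l}[u|w w' u l ew _ IH] uv.
  by split=> // uv'; rewrite uv' eqxx in uv.
have [IH1 IH2] := IH uv; split=> [wv|wv a eva av].
  have [w'v|w'v] := eqVneq w' v.
    by apply: IH2 => //; rewrite e_sym -w'v.
  apply: connect_trans (IH1 w'v) (connect1 _).
  by rewrite delete1E wv w'v sub_complete // e_sym.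
subst w; have w'v : w' != v by apply: contraTneq ew => ->; rewrite e_irr.
have [<-|w'a] := eqVneq w' a; first exact: IH1.
apply: connect_trans (IH1 w'v) (connect1 _).
by rewrite delete1E w'v av /complete w'a ew eva orbT.
Qed.

Lemma connect_delete_off v e u w :
    ~~ connect e u v -> connect e u w ->
  [/\ u != v, w != v & connect (delete [set v] e) u w].
Proof.
move=> uv uw.
have off x : connect e u x -> x != v.
  by move=> ux; apply: contraNneq uv => <-.
split; [exact/off/connect0 | exact: off |].
have [l uwl] := connect_walk uw.
suff walk_off x : connect e u x -> walk e x w l -> connect (delete [set v] e) x w.
  exact/walk_off/uwl.
move=> + xw; elim: xw {uw uwl} => {x w l}[x|x x' w l exx' _ IH] ux.
  exact: connect0.
have ux' : connect e u x' by apply: connect_trans ux (connect1 exx').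
apply: connect_trans (connect1 _) (IH ux').
by rewrite delete1E exx' !off.
Qed.

(** * Systems of far pairs *)

(** The truncation makes a bound of 1 hold for any pair, including the pair made
   of a single vertex. *)
Definition far e u w k := forall l, walk e u w l -> k <= maxn 1 l.

Definition ecc e u k := exists2 w, connect e u w & far e u w k.

(** A selection of vertices u in distinct components, where k u bounds the
   distance from u to some vertex from below and k u = 0 encodes that u is not
   selected.  Unlike a diameter, such a pair survives most deletions unchanged,
   and it can be modified in one component alone. *)
Definition far_system e U (k : T -> nat) :=
  (forall u, 0 < k u -> u \notin U /\ ecc e u (k u)) /\
  (forall u u', 0 < k u -> 0 < k u' -> connect e u u' -> u = u').

Definition far_off v e U (k : T -> nat) := forall u, 0 < k u ->
  u != v /\ exists w, [/\ w != v, connect e u w & far e u w (k u)].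

Definition persists v e u k := u != v /\
  exists w, [/\ w != v, connect (delete [set v] e) u w & far e u w k].

Lemma persists_off v e u k : ~~ connect e u v -> ecc e u k -> persists v e u k.
Proof.
move=> uv [w uw fw]; have [uv' wv uw'] := connect_delete_off uv uw.
by split=> //; exists w.
Qed.

Lemma connect_delete_sub (C : {set T}) e u w :
  connect (delete C e) u w -> connect e u w.
Proof. exact/connect_subrel/sub_delete. Qed.

Lemma persists_ecc v e u k : persists v e u k -> ecc (delete [set v] e) u k.
Proof.
move=> [_ [w [_ uw fw]]]; exists w => // l /(walk_sub (@sub_delete _ e)).
exact: fw.
Qed.

Lemma far_system_delete v e U k : far_system e U k ->
    (forall u, 0 < k u -> persists v e u (k u)) ->
  far_system (delete [set v] e) (v |: U) k.
Proof.
move=> [k1 k2] kv; split=> [u ku|u u' ku ku' /connect_delete_sub]; last exact: k2.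
split; last exact/persists_ecc/kv.
have [uU _] := k1 u ku; have [uv _] := kv u ku.
by rewrite in_setU1 negb_or uv.
Qed.

(** Distances drop by at most one, and only in the component of v, which has at
   most one selected vertex. *)
Lemma far_system_complete v e U k :
    ssrbool.symmetric e -> irreflexive e -> far_system e U k -> far_off v e U k ->
  exists k', [/\ far_system (complete v e) U k',
    far_system (delete [set v] (complete v e)) (v |: U) k' &
    \sum_u k u <= (\sum_u k' u).+1].
Proof.
move=> e_sym e_irr [k1 k2] kv.
(* A bound of 1 need not be lowered, since it holds for every pair. *)
pose k' u := if connect e u v then maxn (minn 1 (k u)) (k u).-1 else k u.
have k'0 u : 0 < k' u -> 0 < k u.
  by rewrite /k'; case: ifP => // _; case: (k u).
have fark' u w : 0 < k u -> far e u w (k u) -> far (complete v e) u w (k' u).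
  move=> ku fw l /(walk_complete e_sym); rewrite /k'.
  case: ifPn => [_|uv] [[l' l'l /fw]|[[m ml] uv'] [l' l'l /fw]]; try lia.
  by rewrite (walk_connect uv') in uv.
exists k'; split.
- split=> [u /k'0 ku|u u' /k'0 ku /k'0 ku']; last first.
    by rewrite connect_complete //; apply: k2.
  have [uU _] := k1 u ku; split=> //.
  have [_ [w [_ uw fw]]] := kv u ku; exists w; last exact: fark'.
  by rewrite connect_complete.
- split=> [u /k'0 ku|u u' /k'0 ku /k'0 ku' /connect_delete_sub]; last first.
    by rewrite connect_complete //; apply: k2.
  have [uU _] := k1 u ku; have [uv [w [wv uw fw]]] := kv u ku.
  split; first by rewrite in_setU1 negb_or uv.
  exists w; first exact: connect_delete_complete.
  move=> l /(walk_sub (@sub_delete _ _)); exact: fark'.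
- have sum_k : \sum_u k u <= \sum_u (k' u + ((0 < k u) && connect e u v)).
    apply: leq_sum => u _; rewrite /k'.
    by case: (connect e u v); case: (k u) => [|m] //=; lia.
  apply: leq_trans sum_k _; rewrite big_split /= -[X in _ <= X]addn1 leq_add2l.
  rewrite -big_mkcond /= sum1_card; apply/card_le1_eqP => u u'.
  rewrite !unfold_in => /andP[ku uv] /andP[ku' u'v]; apply: k2 => //.
  by apply: connect_trans u'v _; rewrite (sym_connect_sym e_sym).
Qed.
End Walks.

(** * Splitting a geodesic at a vertex *)

Section Geodesic.
Variable n : nat.
Local Notation T := 'I_n.
Local Open Scope nat_scope.
Variables (e : rel T) (P : nat -> T) (d : nat).
Hypotheses (e_sym : ssrbool.symmetric e) (e_irr : irreflexive e).
Hypothesis P_edge : forall i, i < d -> e (P i) (P i.+1).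
Hypothesis P_min : forall l, walk e (P 0) (P d) l -> d <= l.
Hypothesis P_nonfree : forall v, ~~ free_vertex e v -> connect e (P 0) v ->
  exists2 i, i <= d & v = P i.
Hypothesis P_cut : forall i, 0 < i < d ->
  ~~ connect (delete [set P i] e) (P 0) (P d).

Lemma P_walk i j : i <= j <= d -> walk e (P i) (P j) (j - i).
Proof.
move=> /andP[ij jd]; move: jd; rewrite -{1 2}(subnKC ij).
elim: (j - i) => [_|m IH jd]; first by rewrite addn0; apply: walk_nil.
by rewrite addnS; apply: walk_rcons (IH _) (P_edge _); lia.
Qed.

Lemma P_dist i j l : i <= j <= d -> walk e (P i) (P j) l -> j - i <= l.
Proof.
move=> /andP[ij jd] wl.
have w0 : walk e (P 0) (P i) (i - 0) by apply: P_walk; lia.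
have wd : walk e (P j) (P d) (d - j) by apply: P_walk; lia.
by have := P_min (walk_cat w0 (walk_cat wl wd)); lia.
Qed.

Lemma P_dist_rev i j l : i <= j <= d -> walk e (P j) (P i) l -> j - i <= l.
Proof. by move=> ijd /(walk_sym e_sym); apply: P_dist. Qed.

Lemma P_adj i j : i <= d -> j <= d -> e (P i) (P j) -> j <= i.+1.
Proof.
move=> iD jD eij; have [ij|/ltnW] := leqP i j; last by move=> ?; apply: leqW.
have /P_dist : walk e (P i) (P j) 1 by apply: walk_cons eij (walk_nil _ _).
by move=> /(_ _); rewrite ij jD => /(_ isT); lia.
Qed.

Lemma P_inj i j : i <= d -> j <= d -> P i = P j -> i = j.
Proof.
wlog ij : i j / i <= j => [H iD jD ePij|iD jD ePij].
  by have [/H->|/ltnW/H<-] := leqP i j.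
have /P_dist : walk e (P i) (P j) 0 by rewrite ePij; apply: walk_nil.
by rewrite ij jD => /(_ isT); lia.
Qed.

Lemma P_connect i : i <= d -> connect e (P 0) (P i).
Proof. by move=> iD; apply: (@walk_connect _ _ _ _ (i - 0)); apply: P_walk. Qed.

Lemma P_connect_delete i j k : i <= d -> j <= k <= d -> (k < i) || (i < j) ->
  connect (delete [set P i] e) (P j) (P k).
Proof.
move=> iD /andP[jk kd]; move: kd; rewrite -(subnKC jk).
elim: (k - j) => [|m IH] jd ijk; first by rewrite addn0 connect0.
apply: connect_trans (IH _ _) (connect1 _); try by lia.
rewrite addnS delete1E P_edge; last by lia.
by apply/and3P; split=> //; apply/eqP => /P_inj; lia.
Qed.

Definition on_path v := exists2 i, i <= d & v = P i.

Lemma off_path_free v : connect e (P 0) v -> ~ on_path v -> free_vertex e v.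
Proof.
by move=> Pv off; apply: contrapT => /negP nfv; apply/off/P_nonfree.
Qed.

(** Free vertices are never interior to a shortest walk, so a shortest walk from
   a vertex off the geodesic towards one of its vertices enters it at once. *)
Lemma walk_to_path s t l : connect e (P 0) s -> ~ on_path s -> on_path t ->
    walk e s t l ->
  exists k l', [/\ k <= d, e s (P k), l' < l & walk e (P k) t l'].
Proof.
move=> + + t_on; have [m] := ubnP l; elim: m => // m IH in s l *.
rewrite ltnS => lm Ps s_off st.
case: l st lm => [/walkE st|l /walkE[v esv vt] lm]; first by rewrite st in s_off.
have Pv : connect e (P 0) v by apply: connect_trans Ps (connect1 esv).
have [[k kd vE]|v_off] := pselect (on_path v).
  by exists k, l; rewrite -vE.
have /free_vertexP v_free := off_path_free Pv v_off.
case: l vt lm => [/walkE vt|l /walkE[w evw wt] lm]; first by rewrite vt in v_off.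
have [ws|ws] := eqVneq w s.
  have [||k [l' [kd esk l'l Pkt]]] // := IH s l _ Ps s_off; first by lia.
    by rewrite -ws.
  by exists k, l'; split=> //; lia.
have esw : e s w by rewrite e_sym in esv; apply: v_free; rewrite // eq_sym.
have [||k [l' [kd esk l'l Pkt]]] // := IH s l.+1 _ Ps s_off.
  exact: walk_cons esw wt.
by exists k, l'; split=> //; lia.
Qed.

Lemma path_neighbours s i k : connect e (P 0) s -> ~ on_path s ->
  i <= d -> k <= d -> e s (P i) -> e s (P k) -> k <= i.+1 /\ i <= k.+1.
Proof.
move=> Ps s_off iD kD esi esk; have [<-|ik] := eqVneq i k.
  by rewrite leqnSn.
have /free_vertexP s_free := off_path_free Ps s_off.
have eik : e (P i) (P k).
  by apply: s_free => //; apply/eqP => /P_inj; move/eqP: ik; auto.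
by split; apply: P_adj; rewrite // e_sym.
Qed.

(** Removing P i leaves a far pair at P 0 and another one at y, of total
   distance d; one unit may be missing if a vertex becomes free instead. *)
Definition good_split i := exists y a b,
  [/\ ecc (delete [set P i] e) (P 0) a, ecc (delete [set P i] e) y b,
      [/\ 0 < a, 0 < b, connect e (P 0) y & y != P i],
      ~~ connect (delete [set P i] e) (P 0) y &
      d <= a + b \/ d <= (a + b).+1 /\ exists z,
        [/\ ~~ free_vertex e z, z != P i & free_vertex (delete [set P i] e) z]].

Lemma good_split_right i a y w b : 0 < i < d -> 0 < a -> 0 < b ->
    ecc (delete [set P i] e) (P 0) a ->
    connect (delete [set P i] e) y (P d) -> connect (delete [set P i] e) y w ->
    far e y w b ->
    d <= a + b \/ d <= (a + b).+1 /\ (exists z,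
      [/\ ~~ free_vertex e z, z != P i & free_vertex (delete [set P i] e) z]) ->
  good_split i.
Proof.
move=> iD a0 b0 ecc_a y_d yw fw dab; exists y, a, b.
have sym_del := sym_connect_sym (delete_sym [set P i] e_sym).
have yPi : y != P i.
  apply: contraTneq y_d => ->; apply/negP => /connectP[[|v p] /=].
    by move=> _ /P_inj; lia.
  by rewrite delete1E eqxx andbF.
have e_sym' := sym_connect_sym e_sym.
split=> //.
- by exists w => // l /(walk_sub (@sub_delete _ _ _)); apply: fw.
- split=> //; rewrite e_sym'.
  by apply: connect_trans (connect_delete_sub y_d) _; rewrite e_sym' P_connect.
- by apply/negP => Py; have /negP[] := P_cut iD; apply: connect_trans Py y_d.
Qed.

(** Starting at the left end, move right two steps at a time: if no split is
   found at P i, then P (i + 1) and P (i + 2) have a common neighbour off the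
   geodesic, which has distance at least i + 2 from P 0 and remains
   connected to it when P (i + 2) is removed. *)
Lemma good_split_from i : 0 < i < d -> ecc (delete [set P i] e) (P 0) i ->
  exists2 j, 0 < j < d & good_split j.
Proof.
have [m] := ubnP (d - i); elim: m => // m IH in i *.
rewrite ltnS => dm iD ecc_i; have [i0 id] := andP iD.
have sym_del j := sym_connect_sym (delete_sym [set P j] e_sym).
have [i1d|di1] := ltnP i.+1 d; last first.
  exists i => //; apply: (good_split_right (w := P d) (b := 1) iD _ _ ecc_i).
  - by [].
  - by [].
  - exact: connect0.
  - exact: connect0.
  - by move=> l _; rewrite leq_max.
  - by left; lia.
have i1_d : connect (delete [set P i] e) (P i.+1) (P d).
  by apply: P_connect_delete; clear - i1d; lia.
have Pi_i1 : P i != P i.+1.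
  by apply/eqP => /P_inj; clear - id; lia.
have [i1_free|i1_nonfree] := boolP (free_vertex (delete [set P i] e) (P i.+1)).
  exists i => //.
  apply: (good_split_right (w := P d) (b := d - i.+1) iD _ _ ecc_i i1_d i1_d).
  - by [].
  - by rewrite subn_gt0.
  - move=> l /P_dist; rewrite leqnn andbT => /(_ id).
    by clear; lia.
  - right; split; first by clear - i1d; lia.
    exists (P i.+1); split=> //; last by rewrite eq_sym Pi_i1.
    apply/free_vertexP => i1f.
    have ei : e (P i.+1) (P i) by rewrite e_sym P_edge.
    have := i1f _ _ ei (P_edge i1d).
    case: eqP => [/P_inj|_ /(_ isT)/P_adj]; clear - i1d; lia.
have [s [t []]] := nonfreeP i1_nonfree.
rewrite !delete1E => /and3P[es _ si] /and3P[et _ ti] st est.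
have {}est : ~~ e s t by move: est; rewrite si ti !andbT.
have P_i1 v : e (P i.+1) v -> connect e (P 0) v.
  by move=> ev; apply: connect_trans (connect1 ev); apply: P_connect.
have nbr_off v : e (P i.+1) v -> v != P i -> v != P i.+2 -> ~ on_path v.
  move=> ev vi vi2 [k kd vE].
  have e' := ev; rewrite vE in e' vi vi2; have ki := P_adj (ltnW i1d) kd e'.
  rewrite e_sym in e'; have ik := P_adj kd (ltnW i1d) e'.
  have : [|| k == i, k == i.+1 | k == i.+2] by clear - ki ik; lia.
  case/or3P=> /eqP kE; move: e' vi vi2; rewrite kE ?eqxx // e_irr //.
have i1_conn v : e (P i.+1) v -> v != P i ->
    connect (delete [set P i] e) (P i.+1) v.
  move=> ev vi; apply: connect1; rewrite delete1E ev vi andbT /=.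
  by rewrite eq_sym.
have split_far v : e (P i.+1) v -> v != P i -> v != P i.+2 -> ~~ e v (P i.+2) ->
    exists2 j, 0 < j < d & good_split j.
  move=> ev vi vi2 evi2; have v_off := nbr_off v ev vi vi2.
  have v_d : connect (delete [set P i] e) v (P d).
    by apply: connect_trans i1_d; rewrite sym_del i1_conn.
  exists i => //.
  apply: (good_split_right (w := P d) (b := d - i) iD _ _ ecc_i v_d v_d).
  - by [].
  - by rewrite subn_gt0.
  - move=> l /(walk_to_path (P_i1 v ev) v_off).
    case=> [|k [l' [kd evk l'l Pkd]]]; first by exists d.
    have ev' : e v (P i.+1) by rewrite e_sym.
    have [ki _] := path_neighbours (P_i1 v ev) v_off (ltnW i1d) kd ev' evk.
    have ki2 : k != i.+2 by apply: contraNneq evi2 => <-.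
    have := P_dist _ Pkd; rewrite kd leqnn => /(_ isT).
    by clear - ki ki2 l'l; lia.
  - by left; clear - id; lia.
have [si2|si2] := eqVneq s (P i.+2).
  have [ti2|ti2] := eqVneq t (P i.+2); first by rewrite si2 ti2 eqxx in st.
  by apply: (split_far t) => //; rewrite e_sym -si2.
have [esi2|] := boolP (e s (P i.+2)); last exact: split_far.
have [i2d|di2] := ltnP i.+2 d; last first.
  exists i => //.
  apply: (good_split_right (y := s) (w := t) (b := 2) iD _ _ ecc_i).
  - by [].
  - by [].
  - by apply: connect_trans i1_d; rewrite sym_del i1_conn.
  - by apply: connect_trans (i1_conn t et ti); rewrite sym_del i1_conn.
  - case=> [|[|l]] wst; last by rewrite leq_max orbT.
      by move: st; rewrite (walkE wst) eqxx.
    by have [v esv /walkE vt] := walkE wst; rewrite -vt esv in est.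
  - by left; clear - di2; lia.
apply: (IH i.+2) => //; first by clear - dm i2d; lia.
exists s.
  apply: (@connect_trans _ _ (P i.+1)); first by apply: P_connect_delete; clear - i2d; lia.
  apply: connect1; rewrite delete1E es si2 andbT /=.
  by apply/eqP => /P_inj; clear - i2d; lia.
have s_off := nbr_off s es si si2.
move=> l /(walk_sub (@sub_delete _ _ _))/(walk_sym e_sym).
case/(walk_to_path (P_i1 s es) s_off) => [|k [l' [kd esk l'l Pk0]]].
  by exists 0.
have es' : e s (P i.+1) by rewrite e_sym.
have [_ ik1] := path_neighbours (P_i1 s es) s_off i1d kd esi2 esk.
have := P_dist_rev _ Pk0; rewrite kd leq0n => /(_ isT).
by clear - ik1 l'l; lia.
Qed.

Lemma good_split_exists : 1 < d -> exists2 j, 0 < j < d & good_split j.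
Proof.
move=> d1; apply: (@good_split_from 1) => //.
exists (P 0); first exact: connect0.
by move=> l _; rewrite leq_max.
Qed.
End Geodesic.

(** * Choosing the vertex *)

Section Selection.
Variables (n : nat) (e : rel 'I_n) (U : {set 'I_n}) (k : 'I_n -> nat).
Local Notation T := 'I_n.
Local Open Scope nat_scope.
Hypotheses (e_sym : ssrbool.symmetric e) (e_irr : irreflexive e).
Hypothesis eU : forall i j, e i j -> i \notin U.
Hypothesis k_sys : far_system e U k.

Lemma connect_alive u v : connect e u v -> u \notin U -> v \notin U.
Proof.
case/connect_walk=> [[|l]] /(walk_sym e_sym)/walkE; first by move=> ->.
by case=> w /eU.
Qed.

Lemma nonfree_alive v : ~~ free_vertex e v -> v \notin U.
Proof. by move=> /nonfreeP[a [b [/eU]]]. Qed.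

Lemma alive_free_delete_le v : ~~ free_vertex e v ->
  alive_free e U <= alive_free (delete [set v] e) (v |: U).
Proof.
move=> nfv; apply: alive_free_delete => [||u]; [exact: eU| |exact: free_delete].
by move=> u fu; apply: contraNneq nfv => <-.
Qed.

(** A vertex v at which the induction can proceed: k' is a system not having v
   as an end of a selected pair, hence suited to G_v and G_v - v, and k1 is a
   system for G - v. *)
Definition good_vertex v := ~~ free_vertex e v /\
  exists k' k1, [/\ far_system e U k', far_off v e U k',
    \sum_u k u <= \sum_u k' u, far_system (delete [set v] e) (v |: U) k1 &
    alive_free e U + \sum_u k u <=
      alive_free (delete [set v] e) (v |: U) + \sum_u k1 u].

Lemma good_vertex_persists v k' : ~~ free_vertex e v -> far_system e U k' ->
    \sum_u k u <= \sum_u k' u ->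
    (forall u, 0 < k' u -> persists v e u (k' u)) ->
  good_vertex v.
Proof.
move=> nfv k'_sys kk' k'v; split=> //; exists k', k'; split=> //.
- move=> u /k'v[uv [w [wv uw fw]]]; split=> //; exists w; split=> //.
  exact: connect_delete_sub uw.
- exact: far_system_delete.
- by rewrite leq_add // alive_free_delete_le.
Qed.

(** A selected vertex with bound 1 can be exchanged for any neighbour. *)
Lemma good_vertex_move v : ~~ free_vertex e v -> k v = 1 -> good_vertex v.
Proof.
move=> nfv kv; have [k1 k2] := k_sys.
have [a [_ [eva _ _ _]]] := nonfreeP nfv.
have av : a != v by apply: contraTneq eva => ->; rewrite e_irr.
have ka : k a = 0.
  apply/eqP; rewrite -leqn0 leqNgt; apply/negP => ka.
  by have := k2 v a; rewrite kv ka connect1 // => /(_ isT isT isT) va; rewrite va eqxx in av.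
pose k' u := if u == v then 0 else if u == a then 1 else k u.
have k'_off u : u != v -> u != a -> 0 < k u -> ~~ connect e u v.
  by move=> uv _ ku; apply: contraNN uv => uv'; rewrite (k2 u v) ?kv.
have k'_pers u : 0 < k' u -> persists v e u (k' u).
  rewrite /k'; case: eqVneq => // uv; case: eqVneq => [-> _|ua ku].
    split=> //; exists a; split=> //.
    by move=> l _; rewrite leq_max.
  apply: persists_off; first exact: k'_off.
  by have [] := k1 u ku.
apply: (good_vertex_persists (k' := k')) => //.
  split=> [u k'u|u u'].
    split; last first.
      have [_ [w [_ uw fw]]] := k'_pers u k'u.
      by exists w; [apply: connect_delete_sub uw|].
    move: k'u; rewrite /k'; case: eqVneq => // uv; case: eqVneq => [-> _|_ ku].
      by apply: (connect_alive (connect1 eva)); have [] := k1 v _; rewrite ?kv.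
    by have [] := k1 u ku.
  rewrite /k'; case: eqVneq => // uv; case: eqVneq => [ua _|ua ku];
    case: eqVneq => // u'v; case: eqVneq => [u'a _|u'a ku'] uu'.
  - by rewrite ua u'a.
  - have /negP[] := k'_off u' u'v u'a ku'.
    apply: (@connect_trans _ _ a); last by apply: connect1; rewrite e_sym.
    by rewrite (sym_connect_sym e_sym) -ua.
  - have /negP[] := k'_off u uv ua ku.
    apply: (@connect_trans _ _ a); last by apply: connect1; rewrite e_sym.
    by rewrite -u'a.
  - exact: k2.
rewrite (bigD1 v) //= (bigD1 a) //= [X in _ <= X](bigD1 v) //= [X in _ <= _ + X](bigD1 a) //=.
rewrite /k' !eqxx (negPf av) kv ka !add0n !add1n ltnS.
by apply: leq_sum => u /andP[/negPf -> /negPf ->].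
Qed.

(** If no choice of v preserves the given system, each non-free vertex is an end
   of the selected pair of its component or separates it.  A pair with bound 1
   can be moved away from v; otherwise the non-free vertices of the component
   lie on a geodesic, which is split at one of its interior vertices. *)
Lemma exists_good_vertex v0 : ~~ free_vertex e v0 -> exists v, good_vertex v.
Proof.
move=> nfv0; have [k1 k2] := k_sys.
have [[v [nfv v_pers]]|no_pers] := pselect (exists v, ~~ free_vertex e v /\
    forall u, 0 < k u -> persists v e u (k u)).
  by exists v; apply: good_vertex_persists v_pers.
have not_pers v : ~~ free_vertex e v ->
    exists u, [/\ 0 < k u, connect e u v & ~ persists v e u (k u)].
  move=> nfv; apply: contrapT => none; apply: no_pers; exists v; split=> // u ku.
  have [uv|uv] := boolP (connect e u v); last by apply: persists_off; have [] := k1 u ku.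
  by apply: contrapT => npers; apply: none; exists u.
have [u [ku uv0 npers]] := not_pers v0 nfv0.
have [k_1|k_2] := leqP (k u) 1.
  have {k_1}ku1 : k u = 1 by lia.
  have [uv|uv] := eqVneq u v0; first by exists u; apply: good_vertex_move; rewrite // uv.
  case: npers; split=> //; exists u; split=> //.
  by move=> l _; rewrite ku1 leq_max.
have [uU [w uw fw]] := k1 u ku.
have [|d /asboolP wd d_min] := ex_minnP (P := fun l => `[< walk e u w l >]).
  by have [l uwl] := connect_walk uw; exists l; apply/asboolP.
have [P [P0 Pd P_edge]] := walk_path_points wd.
have kud : k u <= d by have := fw d wd; lia.
have d1 : 1 < d by lia.
have P_min l : walk e (P 0) (P d) l -> d <= l.
  by rewrite P0 Pd => /asboolP; apply: d_min.
have only_u v : ~~ free_vertex e v -> connect e u v -> ~ persists v e u (k u).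
  move=> nfv uv; have [u' [ku' u'v]] := not_pers v nfv.
  suff -> : u' = u by [].
  apply: k2 => //; apply: connect_trans u'v _.
  by rewrite (sym_connect_sym e_sym).
have P_nonfree v : ~~ free_vertex e v -> connect e (P 0) v ->
    exists2 i, i <= d & v = P i.
  rewrite P0 => nfv uv; apply: contrapT => v_off; apply: (only_u v nfv uv).
  have vP i : i <= d -> P i != v by move=> iD; apply/eqP => Piv; apply: v_off; exists i.
  split; first by rewrite -P0 vP.
  exists w; split=> //; first by rewrite -Pd vP.
  suff conn i : i <= d -> connect (delete [set v] e) (P 0) (P i).
    by rewrite -P0 -Pd conn.
  elim: i => [|i IH] iD; first exact: connect0.
  apply: connect_trans (IH (ltnW iD)) (connect1 _).
  by rewrite delete1E P_edge // !vP // ltnW.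
have P_int i : 0 < i < d -> ~~ free_vertex e (P i).
  case: i => [|i] // /= iD; apply/negP => /free_vertexP fi.
  have ei : e (P i.+1) (P i) by rewrite e_sym P_edge // ltnW.
  have := fi _ _ ei (P_edge _ iD).
  case: eqP => [/(P_inj P_edge P_min)|_ /(_ isT)/(P_adj P_edge P_min)]; lia.
have P_cut i : 0 < i < d -> ~~ connect (delete [set P i] e) (P 0) (P d).
  move=> iD; apply/negP; rewrite P0 Pd => uw'.
  have iD' : i <= d by lia.
  apply: (only_u (P i)); first exact: P_int.
    by rewrite -P0; exact: (P_connect P_edge iD').
  split; first by rewrite -P0; apply/eqP => /(P_inj P_edge P_min); clear - iD; lia.
  exists w; split=> //.
  by rewrite -Pd; apply/eqP => /(P_inj P_edge P_min); clear - iD; lia.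
have [i iD] := good_split_exists e_sym e_irr P_edge P_min P_nonfree P_cut d1.
move=> [y [a [b [ecc_a ecc_b [a0 b0 P0y yPi] Py dab]]]].
rewrite P0 in ecc_a P0y Py.
have iD' : i <= d by case/andP: iD => _ /ltnW.
have uPi : u != P i by rewrite -P0; apply/eqP => /(P_inj P_edge P_min); clear - iD; lia.
have wPi : w != P i by rewrite -Pd; apply/eqP => /(P_inj P_edge P_min); clear - iD; lia.
have uPi_conn : connect e u (P i) by rewrite -P0; exact: (P_connect P_edge iD').
have yu : y != u by apply: contraNneq Py => ->; apply: connect0.
have ky : k y = 0.
  apply/eqP; rewrite -leqn0 leqNgt; apply/negP => ky.
  by have uy := k2 _ _ ku ky P0y; rewrite uy eqxx in yu.
have other z : 0 < k z -> z != u -> ~~ connect e u z.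
  by move=> kz; apply: contraNN => uz; rewrite (k2 _ _ ku kz uz).
have nfPi := P_int i iD.
have conn_sym := sym_connect_sym e_sym.
exists (P i); split=> //.
(* The pair of u and w is replaced by the two pairs that the split provides. *)
pose kk z := if z == u then a else if z == y then b else k z.
have other_pers z : 0 < k z -> z != u -> persists (P i) e z (k z).
  move=> kz zu; apply: persists_off; last by have [] := k1 z kz.
  apply: contraNN (other z kz zu) => zPi.
  by apply: connect_trans uPi_conn _; rewrite conn_sym.
exists k, kk; split=> //.
- move=> z kz; have [->|zu] := eqVneq z u; first by split=> //; exists w.
  have [zPi [w' [w'Pi zw' fw']]] := other_pers z kz zu; split=> //.
  by exists w'; split=> //; apply: connect_delete_sub zw'.
- split=> [z|z z'].
    rewrite /kk in_setU1 negb_or; case: eqVneq => [-> _|zu].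
      by rewrite uPi.
    case: eqVneq => [-> _|zy kz].
      by rewrite yPi (connect_alive P0y).
    have [-> _] := other_pers z kz zu; have [-> _] := k1 z kz.
    by split=> //; apply/persists_ecc/other_pers.
  rewrite /kk; case: eqVneq => [-> _|zu]; [|case: eqVneq => [-> _|zy kz]];
    (case: eqVneq => [-> _|z'u]; [|case: eqVneq => [-> _|z'y kz']]) => zz' //.
  + by rewrite zz' in Py.
  + by have /negP[] := other z' kz' z'u; apply: connect_delete_sub zz'.
  + by move: zz'; rewrite (sym_connect_sym (delete_sym _ e_sym)) (negPf Py).
  + have /negP[] := other z' kz' z'u.
    by apply: connect_trans P0y (connect_delete_sub zz').
  + have /negP[] := other z kz zu.
    by rewrite conn_sym; apply: connect_delete_sub zz'.
  + have /negP[] := other z kz zu; apply: connect_trans P0y _.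
    by rewrite conn_sym; apply: connect_delete_sub zz'.
  + by apply: k2 => //; apply: connect_delete_sub zz'.
- have sum_kk : \sum_z kk z + k u = a + b + \sum_z k z.
    rewrite (bigD1 u) //= (bigD1 y) //= [in RHS](bigD1 u) //= [in RHS](bigD1 y) //=.
    rewrite /kk !eqxx (negPf yu) ky add0n.
    under eq_bigr => z /andP[/negPf -> /negPf ->] do [].
    by clear; lia.
  case: dab => [dab|[dab [z [nfz zPi fz]]]].
    by have := alive_free_delete_le nfPi; clear - dab sum_kk kud; lia.
  have : alive_free e U < alive_free (delete [set P i] e) (P i |: U).
    apply: (alive_free_lt (z := z)) => // [v vU fv|].
      rewrite in_setU1 negb_or vU free_delete // !andbT.
      by apply: contraNneq nfPi => <-.
    by rewrite in_setU1 negb_or zPi nonfree_alive.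
  by clear - dab sum_kk kud; lia.
Qed.
End Selection.

(** * The lower bound *)

Section LowerBound.
Variables (K : fieldType) (n : nat).
Implicit Types (e : rel 'I_n) (U : {set 'I_n}) (k : 'I_n -> nat).

Lemma cluster_connect e u w : ssrbool.symmetric e -> cluster e -> connect e u w ->
  u = w \/ e u w.
Proof.
move=> e_sym e_cl /connect_walk[l]; elim=> {u w l}[u|u v w l euv _]; first by left.
case=> [<-|evw]; first by right.
have [->|uw] := eqVneq u w; first by left.
by right; apply: (e_cl v) => //; rewrite e_sym.
Qed.

Lemma edge_depth_lower_bound e U k :
    ssrbool.symmetric e -> irreflexive e -> (forall i j, e i j -> i \notin U) ->
    far_system e U k ->
  edge_depth_ge K (alive_free e U + \sum_u k u)%N e U U.
Proof.
have [m] := ubnP (nonfree e); elim: m => // m IH in e U k *.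
rewrite ltnS => em e_sym e_irr eU k_sys.
have [v0 nfv0|all_free] := pickP (fun v => ~~ free_vertex e v); last first.
  have e_cl : cluster e.
    move=> v i j; have := all_free v => /negbFE/free_vertexP; apply.
  have [k1 k2] := k_sys.
  pose S := [set u | (0 < k u)%N].
  apply: (@depth_ge_leq _ _ (#|~: U| + #|S|)).
    apply: leq_add.
      by apply/subset_leq_card/subsetP => u; rewrite !inE => /andP[].
    rewrite -sum1_card [X in (_ <= X)%N]big_mkcond /=; apply: leq_sum => u _.
    rewrite inE; case: ifPn => [ku|]; last by rewrite -leqNgt.
    have [_ [w uw fw]] := k1 u ku.
    have [uw'|euw] := cluster_connect e_sym e_cl uw.
      by have := fw 0%N; rewrite uw' maxn0 => /(_ (walk_nil _ _)).
    by have := fw 1%N (walk_cons euw (walk_nil _ _)); rewrite maxnn.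
  apply: cluster_depth => //.
  - by move=> i j eij; rewrite (eU _ _ eij).
  - by apply/subsetP => u; rewrite !inE => /k1[].
  - move=> i j; rewrite !inE => ki kj; apply/negP => eij.
    by have ij := k2 _ _ ki kj (connect1 eij); rewrite ij e_irr in eij.
have [v [nfv [k' [k1 [k'_sys k'_off kk' k1_sys sum_k1]]]]] :=
  exists_good_vertex e_sym e_irr eU k_sys nfv0.
have [k2 [k2_sys k2_sys' sum_k2]] := far_system_complete e_sym e_irr k'_sys k'_off.
have vU := nonfree_alive eU nfv.
have eU' i j : complete v e i j -> i \notin U.
  by case/orP=> [/eU //|/and3P[_ + _]]; rewrite e_sym => /eU.
have del_alive e' i j : (forall i j, e' i j -> i \notin U) ->
    delete [set v] e' i j -> i \notin v |: U.
  by move=> e'U; rewrite delete1E in_setU1 negb_or => /and3P[/e'U -> -> _].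
have vv : v \in [set v] by rewrite in_set1.
have free_c u := @free_complete _ v e u e_sym.
apply: (edge_depth_complete (v := v)) => //.
- apply: (depth_ge_leq _ (IH (complete v e) U k2 _ _ _ _ _)) => //.
  + have : (alive_free e U < alive_free (complete v e) U)%N.
      apply: (alive_free_lt (z := v)) => // [u -> /free_c //|].
      exact: free_completed.
    by lia.
  + apply: leq_trans em; apply: nonfree_lt free_c nfv _; exact: free_completed.
  + exact: complete_sym.
  + exact: complete_irr.
- apply: (depth_ge_leq sum_k1 (IH (delete [set v] e) (v |: U) k1 _ _ _ _ _)) => //.
  + apply: leq_trans em; apply: nonfree_lt nfv _ => [u|]; first exact: free_delete.
    exact: free_deleted.
  + exact: delete_sym.
  + exact: delete_irr.
  + by move=> i j; apply: del_alive.
- apply: (depth_ge_leq _ (IH (delete [set v] (complete v e)) (v |: U) k2 _ _ _ _ _)) => //.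
  + have : (alive_free e U <=
            alive_free (delete [set v] (complete v e)) (v |: U))%N.
      apply: alive_free_delete => // [u fu|u /free_c]; last exact: free_delete.
      by apply: contraNneq nfv => <-.
    by lia.
  + apply: leq_trans em; apply: nonfree_lt nfv _ => [u /free_c|]; first exact: free_delete.
    exact: free_deleted.
  + exact/delete_sym/complete_sym.
  + exact/delete_irr/complete_irr.
  + by move=> i j; apply: del_alive.
Qed.

Lemma binomial_edge_ideal_edge e p : ssrbool.symmetric e -> irreflexive e ->
  p \in binomial_edge_ideal K e <-> edge_ideal e set0 set0 p.
Proof.
move=> e_sym e_irr; split=> [/asboolP[h ->]|].
  apply: big_ind => [|q r|ij /andP[_ eij]]; first by constructor.
    exact: generated_add.
  by apply/generated_mul/edge_ideal_edge.
elim=> [|a q r gq _ Jr]; first exact: (rpred0 (binomial_edge_ideal K e)).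
apply: (rpredD (S := binomial_edge_ideal K e)) => //.
apply: (rpredZ (s := binomial_edge_ideal K e) a).
have lt_in (i j : 'I_n) : (i < j)%N -> e i j -> bei_f K i j \in binomial_edge_ideal K e.
  move=> ij eij; apply/asboolP.
  exists (fun kl => (kl == (i, j))%:R); rewrite (bigD1 (i, j)) /= ?ij //.
  rewrite eqxx mul1r big1 ?addr0 // => kl /andP[_ /negPf ->].
  by rewrite mul0r.
case: gq => [i j eij|i|i]; rewrite ?inE //.
have [ij|ji|ij] := ltngtP i j; first exact: lt_in.
  rewrite f_anti -mulN1r; apply: (rpredZ (s := binomial_edge_ideal K e) (-1)).
  by apply: lt_in; rewrite // e_sym.
by rewrite (val_inj ij) e_irr in eij.
Qed.

Lemma depth_bei_lower_bound e k : ssrbool.symmetric e -> irreflexive e ->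
    far_system e set0 k ->
  le_enat (num_free e + \sum_u k u)%N (depth_bei K e).
Proof.
move=> e_sym e_irr k_sys; apply: depth_ge_le_depth.
have -> : num_free e = alive_free e set0.
  by apply: eq_card => u; rewrite !inE.
apply: depth_quot_eq (edge_depth_lower_bound e_sym e_irr _ k_sys) => [p|i j _].
  by apply/idealP/idP => /binomial_edge_ideal_edge; apply.
by rewrite inE.
Qed.
End LowerBound.

(** * Diameters of components as far systems *)

Section Diameter.
Variables (n : nat) (e : rel 'I_n).
Hypothesis e_sym : ssrbool.symmetric e.
Local Open Scope nat_scope.

Lemma diam_attained (T : finType) (e' : rel T) : 0 < #|T| ->
  exists x y, diam e' = dist e' x y.
Proof.
move=> T0; rewrite /diam.
have [x ->] := eq_bigmax (fun u => \max_v dist e' u v) T0.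
by have [y ->] := eq_bigmax (dist e' x) T0; exists x, y.
Qed.

Section Embedding.
Variables (T : finType) (e' : rel T) (h : T -> 'I_n).
Hypothesis h_inj : injective h.
Hypothesis h_lift : forall a b, e (h a) b -> exists2 b', h b' = b & e' a b'.

Lemma lift_walk x u v l : walk e u v l -> h x = u ->
  exists p, [/\ path e' x p, h (last x p) = v & size p = l].
Proof.
move=> uv; elim: uv x => {u v l}[u|u v w l euv _ IH] x hx.
  by exists [::].
rewrite -hx in euv; have [b hb exb] := h_lift euv.
have [p [ep lp sp]] := IH b hb.
by exists (b :: p); rewrite /= exb sp.
Qed.

Lemma dist_le_walk x y l : walk e (h x) (h y) l -> dist e' x y <= l.
Proof.
move=> xy; have [p [ep /h_inj lp sp]] := lift_walk xy erefl.
rewrite leqNgt; apply/negP => l_dist.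
have lT : l < #|T|.
  by apply: leq_trans l_dist _; rewrite -[X in _ <= X](size_iota 0) find_size.
have := before_find 0 l_dist; rewrite nth_iota // add0n => /existsP[].
by exists (Tuple (introT eqP sp)); rewrite /= ep lp eqxx.
Qed.
End Embedding.

(** Summed over the components this is d(G), because the isolated vertices are
   exactly the components of diameter 0. *)
Definition component_weight (C : {set 'I_n}) : nat :=
  maxn 1 (diam (induced e (A := C))).

Lemma component_eq C x : C \in components e -> x \in C ->
  C = [set y | connect e x y].
Proof.
case/imsetP=> z _ -> ; rewrite !inE => zx; apply/setP => y; rewrite !inE.
by rewrite (same_connect (sym_connect_sym e_sym) zx).
Qed.

Lemma component_pair C : C \in components e ->
  exists2 u, u \in C & ecc e u (component_weight C).
Proof.
move=> C_comp; have [z _ CE] := imsetP C_comp.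
have zC : z \in C by rewrite CE !inE connect0.
have [|x [y xy]] := @diam_attained _ (@induced _ e C).
  by apply/card_gt0P; exists (Sub z zC).
exists (val x); first exact: valP.
exists (val y).
  by have := valP y; rewrite /= {2}(component_eq C_comp (valP x)) inE.
move=> l /(@dist_le_walk _ (@induced _ e C) val val_inj) le_l.
rewrite geq_max leq_max /= leq_max /component_weight xy le_l ?orbT //.
move=> a b eab; have bC : b \in C.
  by rewrite (component_eq C_comp (valP a)) inE; apply: connect1.
by exists (Sub b bC).
Qed.

Lemma isolated_component v : (forall u, ~~ e v u) ->
  [set v] \in components e /\ diam (@induced _ e [set v]) = 0.
Proof.
move=> v_iso; split.
  apply/imsetP; exists v => //; apply/setP => y; rewrite !inE.
  apply/eqP/idP => [->|/connect_walk[[|l] /walkE]]; first exact: connect0.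
    by [].
  by case=> w evw; have := v_iso w; rewrite evw.
have [|x [y ->]] := @diam_attained _ (@induced _ e [set v]).
  by apply/card_gt0P; exists (Sub v (set11 v)).
apply/eqP; rewrite -leqn0; apply: (@dist_le_walk _ _ val val_inj).
  move=> a b; have /set1P -> := valP a => evb.
  by have := v_iso b; rewrite evb.
have /set1P -> := valP x; have /set1P -> := valP y; exact: walk_nil.
Qed.

Lemma graph_d_le_weights : graph_d e <= \sum_(C in components e) component_weight C.
Proof.
have -> : \sum_(C in components e) component_weight C =
    \sum_(C in components e) (diam (@induced _ e C) == 0) +
    \sum_(C in components e) diam (@induced _ e C).
  rewrite -big_split /=; apply: eq_bigr => C _; rewrite /component_weight.
  by case: (diam _) => [|m] //; rewrite add0n; apply/maxn_idPr.
rewrite leq_add2r -big_mkcondr /= sum1_card.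
apply: (@leq_trans #|[set [set v] | v in [set v | [forall u, ~~ e v u]]]|).
  by rewrite card_imset //; apply: set1_inj.
apply/subset_leq_card/subsetP => C.
case/imsetP=> v; rewrite inE => /forallP v_iso ->.
have [v_comp diam0] := isolated_component v_iso.
by rewrite unfold_in v_comp diam0.
Qed.

Lemma graph_d_far_system :
  exists2 k, far_system e set0 k & graph_d e <= \sum_u k u.
Proof.
have /choice[r r_pair] : forall C, exists o, C \in components e ->
    exists u, [/\ o = Some u, u \in C & ecc e u (component_weight C)].
  move=> C; have [/component_pair[u uC ecc_u]|nC] := boolP (C \in components e).
    by exists (Some u); exists u.
  by exists None.
pose k u := \sum_(C in components e) if r C == Some u then component_weight C else 0.
have r_in C u : C \in components e -> r C = Some u -> C = [set y | connect e u y].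
  by move=> C_comp; have [v [-> vC _] [<-]] := r_pair C C_comp; apply: component_eq.
have kE u : 0 < k u -> exists2 C, C \in components e &
    r C = Some u /\ k u = component_weight C.
  move=> ku.
  have [C /andP[C_comp /eqP rC]|none] :=
      pickP [pred C in components e | r C == Some u]; last first.
    move: ku; rewrite /k big1 // => C C_comp.
    by have := none C; rewrite /= C_comp /= => ->.
  exists C => //; split=> //; rewrite /k (bigD1 C) //= rC eqxx big1 ?addn0 //.
  move=> D /andP[D_comp DC]; case: eqP => // rD; case/eqP: DC.
  by rewrite (r_in _ _ D_comp rD) -(r_in _ _ C_comp rC).
exists k.
  split=> [u /kE[C C_comp [rC ->]]|u u' /kE[C C_comp [rC _]] /kE[D D_comp [rD _]] uu'].
    by rewrite inE; have [v [+ _ ecc_v]] := r_pair C C_comp; rewrite rC => -[->].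
  apply/Some_inj; rewrite -rC -rD; congr r.
  rewrite (r_in _ _ C_comp rC) (r_in _ _ D_comp rD); apply/setP => y.
  by rewrite !inE (same_connect (sym_connect_sym e_sym) uu').
apply: leq_trans graph_d_le_weights _.
rewrite /k exchange_big /=; apply: leq_sum => C C_comp.
have [u [-> _ _]] := r_pair C C_comp.
by rewrite (bigD1 u) //= eqxx leq_addr.
Qed.

Lemma connected_far_system : connected_graph e ->
  exists2 k, far_system e set0 k & diam e <= \sum_u k u.
Proof.
move=> e_conn; have [n0|n0] := posnP #|'I_n|.
  exists (fun=> 0); first by split.
  by rewrite /diam big_pred0 // => u; have := card0_eq n0 u.
have [x [y ->]] := diam_attained e n0.
exists (fun u => if u == x then dist e x y else 0).
  split=> [u|u u']; last by case: eqP => // -> _; case: eqP.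
  case: eqP => // -> _; rewrite inE; split=> //; exists y => // l.
  move=> /(@dist_le_walk _ e id) xy; rewrite leq_max xy ?orbT //.
  by move=> a b eab; exists b.
by rewrite -big_mkcond /= big_pred1_eq.
Qed.
End Diameter.

Theorem theoremA (K : fieldType) (n : nat) (e : rel 'I_n)
    (e_sym : ssrbool.symmetric e) (e_irr : irreflexive e) :
  le_enat (graph_xi e) (depth_bei K e) /\
  (connected_graph e -> le_enat (num_free e + diam e) (depth_bei K e)).
Proof.
have le_enat_trans k l o : (k <= l)%N -> le_enat l o -> le_enat k o.
  by case: o => //= m; apply: leq_trans.
split=> [|e_conn].
  have [k k_sys dk] := graph_d_far_system e_sym.
  apply: le_enat_trans (depth_bei_lower_bound K e_sym e_irr k_sys).
  by rewrite leq_add2l.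
have [k k_sys dk] := connected_far_system e_conn.
apply: le_enat_trans (depth_bei_lower_bound K e_sym e_irr k_sys).
by rewrite leq_add2l.
Qed.
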